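(* Assume that for all integers $0\le M,N\le 2s$ there exist a non-trivial admissible solution $S_+^{M(i)}=\{u_1,\dots,u_{2s}\}$ of the inhomogeneous Bethe equations $E_+(u_j,\bar u_j)=0$ ($j=1,\dots,2s$) satisfying $$\theta_M=q^{-4s}\Big(\mathsf c^*(\zeta^2+\zeta^{-2})[2s]_q+q^{2s}(\mathsf b q^{2s}+\mathsf c q^{-2s})-q\mathsf c^*\sum_{j=1}^{2s}(qu_j^2+q^{-1}u_j^{-2})\Big),$$ and a non-trivial admissible solution $S_-^{*N(i)}=\{w_1,\dots,w_{2s}\}$ of the inhomogeneous Bethe equations $E_-(w_j,\bar w_j)=0$ ($j=1,\dots,2s$) satisfying $$\theta^*_N=q^{4s}\Big(\mathsf b(\zeta^2+\zeta^{-2})[2s]_q+q^{-2s}(\mathsf b^*q^{2s}+\mathsf c^*q^{-2s})-q^{-1}\mathsf b\sum_{j=1}^{2s}(qw_j^2+q^{-1}w_j^{-2})\Big).$$ Then for all $0\le M,N\le 2s$: $$|\theta_M\rangle=\mathcal N^{(i)}_M(\bar u')\,|\Psi_+^{2s}(\bar u',m_0)\rangle\quad\text{for }\bar u'=S_+^{M(i)},\qquad|\theta^*_N\rangle=\mathcal N^{*(i)}_N(\bar w')\,|\Psi_-^{2s}(\bar w',m_0)\rangle\quad\text{for }\bar w'=S_-^{*N(i)},$$ with $\mathcal N^{(i)}_M(\bar u')=\mathcal N^*_{2s}(\bar u')\,(P^{-1})_{2s,M}$ and $\mathcal N^{*(i)}_N(\bar w')=\mathcal N_{2s}(\bar w'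)\,P_{2s,N}$.
   Context: **Setting.** $q\in\mathbb C^*$ is not a root of unity; $[X,Y]_q=qXY-q^{-1}YX$; $[n]_q=\frac{q^n-q^{-n}}{q-q^{-1}}$; $b(x)=x-x^{-1}$. $s\ge 0$ is an integer or half-integer. $\mathsf b,\mathsf c,\mathsf b^*,\mathsf c^*,\zeta\in\mathbb C^*$ are generic subject to $\mathsf b\mathsf c=\mathsf b^*\mathsf c^*$ (in particular all quantities below are well defined). Put $\theta_M=\mathsf b q^{2M}+\mathsf c q^{-2M}$, $\theta^*_N=\mathsf b^*q^{2N}+\mathsf c^*q^{-2N}$, $\rho=-\mathsf b\mathsf c(q^2-q^{-2})^2$, $\omega=(q-q^{-1})^2\big(\mathsf b\mathsf c(\zeta^2+\zeta^{-2})(q^{2s+1}+q^{-2s-1})-(\mathsf b q^{2s}+\mathsf c q^{-2s})(\mathsf b^*q^{2s}+\mathsf c^*q^{-2s})\big)$, $\eta=-\frac{(q^2-q^{-2})^2}{q+q^{-1}}\mathsf b\mathsf c\big((\mathsf b q^{2s}+\mathsf c q^{-2s})(\zeta^2+\zeta^{-2})-(\mathsf b^*q^{2s}+\mathsf c^*q^{-2s})(q^{2s+1}+q^{-2s-1})\big)$, and $\eta^*$ is obtained from $\eta$ by exchanging $(\mathsf b,\mathsf c)\leftrightarrow(\mathsf b^*,\mathsf c^* )$. $\mathcal V$ is a complex vector space of dimension $2s+1$, and $A,A^*\in\mathrm{End}(\mathcal V)$ (the images $\pi(\mathsf A),\pi(\mathsf A^* )$ of the generators of the Askey-Wilson algebra)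 are diagonalizable, multiplicity-free, act irreducibly on $\mathcal V$, have eigenvalues $\{\theta_M\}_{M=0}^{2s}$ and $\{\theta^*_N\}_{N=0}^{2s}$ respectively, and satisfy the Askey-Wilson relations $[A,[A,A^*]_q]_{q^{-1}}=\rho A^*+\omega A+\eta I$, $[A^*,[A^*,A]_q]_{q^{-1}}=\rho A+\omega A^*+\eta^*I$. They form a Leonard pair: there are eigenbases $A|\theta_M\rangle=\theta_M|\theta_M\rangle$, $A^*|\theta^*_N\rangle=\theta^*_N|\theta^*_N\rangle$ ($0\le M,N\le 2s$) with $A^*|\theta_M\rangle=A^*_{M+1,M}|\theta_{M+1}\rangle+A^*_{M,M}|\theta_M\rangle+A^*_{M-1,M}|\theta_{M-1}\rangle$ and $A|\theta^*_N\rangle=A_{N+1,N}|\theta^*_{N+1}\rangle+A_{N,N}|\theta^*_N\rangle+A_{N-1,N}|\theta^*_{N-1}\rangle$, normalized so that $|\theta^*_0\rangle=\sum_M|\theta_M\rangle$ and $$A^*_{M,M-1}=q^{2-4s}\frac{(1-q^{2M})(\mathsf c-\mathsf b q^{2M+4s})(\mathsf b^*q^{2s-1}\zeta^{-2}+\mathsf b q^{2M-2})(\mathsf c q^{2s-1}\zeta^2+\mathsf c^*q^{2M-2})}{(\mathsf c-\mathsf b q^{4M-2})(\mathsf c-\mathsf b q^{4M})},$$ $$A^*_{M-1,M}=\frac{(1-q^{2M-4s-2})(\mathsf c-\mathsf b q^{2M-2})(\mathsf c+\mathsf b^*\zeta^{-2}q^{2M+2s-1})(\mathsf c^*+\mathsf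 b\zeta^2q^{2M+2s-1})}{(\mathsf c-\mathsf b q^{4M-4})(\mathsf c-\mathsf b q^{4M-2})},$$ $A^*_{M,M}=\theta^*_0-A^*_{M,M+1}-A^*_{M,M-1}$, the coefficients $A_{N,N'}$ being obtained by $(\mathsf b,\mathsf c,\zeta,M)\leftrightarrow(\mathsf b^*,\mathsf c^*,\zeta^{-1},N)$. The transition matrix $P$ is defined by $|\theta^*_N\rangle=\sum_M P_{MN}|\theta_M\rangle$, so $|\theta_M\rangle=\sum_N(P^{-1})_{NM}|\theta^*_N\rangle$. The reference states are $|\Omega^-\rangle=|\theta_0\rangle$, $|\Omega^+\rangle=|\theta^*_0\rangle$. **Bethe states.** Fix $\chi\in\mathbb C^*$ and an integer $m_0$. Put $$\mathcal B(u)=\chi\,b(u^2)\Big(\rho^{-1}\big([A^*,A]_q+\tfrac{\omega}{q-q^{-1}}I\big)+\tfrac{qu^2+q^{-1}u^{-2}}{q^2-q^{-2}}I\Big).$$ - $|\Psi_-^{2s}(\bar w,m_0)\rangle=\mathscr B^-(w_1,m_0+2(2s-1))\cdots\mathscr B^-(w_{2s},m_0)|\Omega^-\rangle$, where $\mathscr B^-(u,m)=\alpha^{-1}q^{m+2}u\,\mathcal B(u)$ with $(q^2-q^{-2})\chi^{-1}\alpha\,\mathsf b\,q^{-m_0}=-1$. - $|\Psi_+^{2s}(\bar u,m_0)\rangle=\mathscr B^+(u_1,m_0+2(2s-1))\cdots\mathscr B^+(u_{2s},m_0)|\Omega^+\rangle$, where $\mathscr B^+(u,m)=\alpha^{-1}q^{-m-2}u^{-1}\mathcal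 B(u)$ with $(q^2-q^{-2})\chi^{-1}\alpha\,\mathsf c^*q^{m_0}=1$. **Normalization.** $\mathcal N_{2s}(\bar w)=\prod_{k=1}^{2s}\big(q\,w_k\,b(w_k^2)A^*_{k,k-1}\big)^{-1}$, $\mathcal N^*_{2s}(\bar u)=\prod_{k=1}^{2s}\big(-q^{-1}u_k^{-1}b(u_k^2)A_{k,k-1}\big)^{-1}$. **Inhomogeneous Bethe equations.** $f(u,v)=\frac{b(qv/u)b(uv)}{b(v/u)b(quv)}$, $h(u,v)=\frac{b(q^2uv)b(qu/v)}{b(quv)b(u/v)}$. For $\epsilon=\pm1$, $$\Lambda_1^\epsilon(u)=\tfrac{q^{-2s-1}}{u^\epsilon}(q^{2s+1}u\zeta^{-1}-u^{-1}\zeta)(q^{2s+1}u\zeta-u^{-1}\zeta^{-1})(u\mathsf c^*q^{-2s}+u^{-1}\mathsf b q^{2s})\Big(u(\tfrac{\mathsf c}{\mathsf c^*})^{\frac{1-\epsilon}2}+u^{-1}(\tfrac{\mathsf b^*}{\mathsf b})^{\frac{1+\epsilon}2}\Big),$$ $$\Lambda_2^\epsilon(u)=\tfrac{(u^2-u^{-2})q^{-2s-1}}{u^\epsilon(qu^2-q^{-1}u^{-2})}(q^{2s-1}u^{-1}\zeta-u\zeta^{-1})(q^{2s-1}u^{-1}\zeta^{-1}-u\zeta)(q^2u\mathsf b q^{2s}+u^{-1}\mathsf c^*q^{-2s})\Big(q^2u(\tfrac{\mathsf b^*}{\mathsf b})^{\frac{1+\epsilon}2}+u^{-1}(\tfrac{\mathsf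 c}{\mathsf c^*})^{\frac{1-\epsilon}2}\Big).$$ With $\nu_+=q^{-1-4s}\mathsf c^*$, $\nu_-=q^{1+4s}\mathsf b$ and $1\le i,j\le 2s$: $$E_\pm(u_i,\bar u_i)=\frac{b(u_i^2)}{b(qu_i^2)}u_i^{\pm1}\prod_{j\ne i}f(u_i,u_j)\Lambda_1^{\pm}(u_i)-(q^2u_i^3)^{\mp1}\prod_{j\ne i}h(u_i,u_j)\Lambda_2^{\pm}(u_i)+\nu_\pm\frac{u_i^{\mp2}b(u_i^2)}{b(q)}\frac{\prod_{k=0}^{2s}b(q^{1/2+k-s}\zeta u_i)b(q^{1/2+k-s}\zeta^{-1}u_i)}{\prod_{j\neq i}b(u_iu_j^{-1})b(qu_iu_j)}.$$ A solution is *non-trivial* if $u_i\ne0$ and $u_i^2\neq u_i^{-2}$ for all $i$, and *admissible* if $U_i\ne U_j$ for $i\neq j$, where $U_i=(qu_i^2+q^{-1}u_i^{-2})/(q+q^{-1})$; the equations are understood where defined ($b(qu_i^2)\ne0$). *)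

(* Defs.v *)
From HB Require Import structures.
From mathcomp Require Import all_boot all_order all_algebra.
From mathcomp Require Export complex reals.

Set Implicit Arguments.
Unset Strict Implicit.
Unset Printing Implicit Defensive.

Import GRing.Theory.

Local Open Scope ring_scope.

(* The (half-)integer spin s enters through the natural number n = 2s.
   q_half is a square root of q, needed only for the powers q^(1/2+k-s); these
   occur in products b(q^(1/2+k-s) zeta u) b(q^(1/2+k-s) u/zeta), which do not
   depend on the choice of the root because b is odd.
   par_bs, par_cs stand for the starred parameters. *)
Record aw_param (C : Type) := AWParam {
  par_q : C; q_half : C;
  par_b : C; par_c : C; par_bs : C; par_cs : C;
  par_zeta : C }.

Section Scalars.
Variables (C : fieldType) (n : nat) (p : aw_param C).
Local Notation q := (par_q p).
Local Notation b := (par_b p).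
Local Notation c := (par_c p).
Local Notation bs := (par_bs p).
Local Notation cs := (par_cs p).
Local Notation zeta := (par_zeta p).
Local Notation N := (n%:Z).

Definition bfun (x : C) : C := x - x^-1.

Definition qint (k : int) : C := (q ^ k - q ^ (- k)) / (q - q^-1).

(* (b, c) <-> (b*, c* ) *)
Definition swap_bc : aw_param C := AWParam q (q_half p) bs cs b c zeta.

(* (b, c, zeta) <-> (b*, c*, 1/zeta) *)
Definition dual_param : aw_param C := AWParam q (q_half p) bs cs b c zeta^-1.

(* "Generic" is read as: the denominators in the entries of A and A* (all of
   the form c - b q^(2k) or c* - b* q^(2k) with 0 <= k <= 4s) do not vanish. *)
Record generic_param : Prop := GenericParam {
  q_neq0 : q != 0;
  q_not_root_of_unity : forall k : nat, (0 < k)%N -> q ^+ k != 1;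
  q_halfE : q_half p ^+ 2 = q;
  b_neq0 : b != 0;
  c_neq0 : c != 0;
  bs_neq0 : bs != 0;
  cs_neq0 : cs != 0;
  zeta_neq0 : zeta != 0;
  bc_eq : b * c = bs * cs;
  bc_generic : forall k : nat, (k <= 2 * n)%N -> c - b * q ^+ (2 * k) != 0;
  bcs_generic : forall k : nat, (k <= 2 * n)%N -> cs - bs * q ^+ (2 * k) != 0 }.

Definition theta (M : nat) : C := b * q ^ (2 * M%:Z) + c * q ^ (- (2 * M%:Z)).

Definition rho : C := - (b * c) * (q ^ 2 - q ^ (-2)) ^+ 2.

Definition omega : C :=
  (q - q^-1) ^+ 2 *
  (b * c * (zeta ^+ 2 + zeta ^- 2) * (q ^ (N + 1) + q ^ (- N - 1))
   - (b * q ^ N + c * q ^ (- N)) * (bs * q ^ N + cs * q ^ (- N))).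

Definition eta : C :=
  - ((q ^ 2 - q ^ (-2)) ^+ 2 / (q + q^-1)) * (b * c) *
  ((b * q ^ N + c * q ^ (- N)) * (zeta ^+ 2 + zeta ^- 2)
   - (bs * q ^ N + cs * q ^ (- N)) * (q ^ (N + 1) + q ^ (- N - 1))).

(* A*_{M,M-1}; it vanishes at M = 0. *)
Definition Astar_up (M : nat) : C :=
  let m := M%:Z in
  q ^ (2 - 2 * N) *
  ((1 - q ^ (2 * m)) * (c - b * q ^ (2 * m + 2 * N)) *
   (bs * q ^ (N - 1) * zeta ^- 2 + b * q ^ (2 * m - 2)) *
   (c * q ^ (N - 1) * zeta ^+ 2 + cs * q ^ (2 * m - 2))) /
  ((c - b * q ^ (4 * m - 2)) * (c - b * q ^ (4 * m))).

(* A*_{M-1,M}; it vanishes at M = 2s + 1. *)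
Definition Astar_down (M : nat) : C :=
  let m := M%:Z in
  ((1 - q ^ (2 * m - 2 * N - 2)) * (c - b * q ^ (2 * m - 2)) *
   (c + bs * zeta ^- 2 * q ^ (2 * m + N - 1)) *
   (cs + b * zeta ^+ 2 * q ^ (2 * m + N - 1))) /
  ((c - b * q ^ (4 * m - 4)) * (c - b * q ^ (4 * m - 2))).

(* f, h of the Bethe equations *)
Definition bethe_f (u v : C) : C :=
  (bfun (q * v / u) * bfun (u * v)) / (bfun (v / u) * bfun (q * u * v)).

Definition bethe_h (u v : C) : C :=
  (bfun (q ^+ 2 * u * v) * bfun (q * u / v)) / (bfun (q * u * v) * bfun (u / v)).

(* The sign epsilon is a boolean, true standing for +1. As exponents in nat,
   ~~ eps and eps are then (1 - epsilon)/2 and (1 + epsilon)/2. *)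
Definition eps_int (eps : bool) : int := if eps then 1 else -1.

Definition Lambda1 (eps : bool) (u : C) : C :=
  q ^ (- N - 1) / u ^ eps_int eps *
  (q ^ (N + 1) * u * zeta^-1 - u^-1 * zeta) *
  (q ^ (N + 1) * u * zeta - u^-1 * zeta^-1) *
  (u * cs * q ^ (- N) + u^-1 * b * q ^ N) *
  (u * (c / cs) ^+ (~~ eps) + u^-1 * (bs / b) ^+ eps).

Definition Lambda2 (eps : bool) (u : C) : C :=
  ((u ^+ 2 - u ^- 2) * q ^ (- N - 1)) /
    (u ^ eps_int eps * (q * u ^+ 2 - q^-1 * u ^- 2)) *
  (q ^ (N - 1) * u^-1 * zeta - u * zeta^-1) *
  (q ^ (N - 1) * u^-1 * zeta^-1 - u * zeta) *
  (q ^+ 2 * u * b * q ^ N + u^-1 * cs * q ^ (- N)) *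
  (q ^+ 2 * u * (bs / b) ^+ eps + u^-1 * (c / cs) ^+ (~~ eps)).

Definition nu (eps : bool) : C :=
  if eps then q ^ (- 1 - 2 * N) * cs else q ^ (1 + 2 * N) * b.

(* E_+ for eps = true, E_- for eps = false *)
Definition bethe_E (eps : bool) (u : 'I_n -> C) (i : 'I_n) : C :=
  let ui := u i in
  bfun (ui ^+ 2) / bfun (q * ui ^+ 2) * ui ^ eps_int eps *
    (\prod_(j < n | j != i) bethe_f ui (u j)) * Lambda1 eps ui
  - (q ^+ 2 * ui ^+ 3) ^ (- eps_int eps) *
    (\prod_(j < n | j != i) bethe_h ui (u j)) * Lambda2 eps ui
  + nu eps * (ui ^ (- (2 * eps_int eps)) * bfun (ui ^+ 2) / bfun q) *
    ((\prod_(k < n.+1) (bfun (q_half p ^ (1 + 2 * k%:Z - N) * zeta * ui) *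
                        bfun (q_half p ^ (1 + 2 * k%:Z - N) * zeta^-1 * ui))) /
     (\prod_(j < n | j != i) (bfun (ui * (u j)^-1) * bfun (q * ui * u j)))).

Definition bethe_U (u : C) : C := (q * u ^+ 2 + q^-1 * u ^- 2) / (q + q^-1).

Definition nontrivial (u : 'I_n -> C) : Prop :=
  forall i, u i != 0 /\ u i ^+ 2 != u i ^- 2.

Definition admissible (u : 'I_n -> C) : Prop :=
  forall i j, i != j -> bethe_U (u i) != bethe_U (u j).

(* Nontriviality, admissibility and bethe_defined together make every
   denominator of bethe_E nonzero. *)
Record bethe_solution (eps : bool) (u : 'I_n -> C) : Prop := BetheSolution {
  bethe_nontrivial : nontrivial u;
  bethe_admissible : admissible u;
  bethe_defined : forall i, bfun (q * u i ^+ 2) != 0;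
  bethe_equations : forall i, bethe_E eps u i = 0 }.

(* eigenvalue of A encoded by a solution of the E_+ equations *)
Definition energy_plus (u : 'I_n -> C) : C :=
  q ^ (- (2 * N)) *
  (cs * (zeta ^+ 2 + zeta ^- 2) * qint N
   + q ^ N * (b * q ^ N + c * q ^ (- N))
   - q * cs * \sum_(j < n) (q * u j ^+ 2 + q^-1 * u j ^- 2)).

(* eigenvalue of A* encoded by a solution of the E_- equations *)
Definition energy_minus (w : 'I_n -> C) : C :=
  q ^ (2 * N) *
  (b * (zeta ^+ 2 + zeta ^- 2) * qint N
   + q ^ (- N) * (bs * q ^ N + cs * q ^ (- N))
   - q^-1 * b * \sum_(j < n) (q * w j ^+ 2 + q^-1 * w j ^- 2)).

End Scalars.

Section DualScalars.
Variables (C : fieldType) (n : nat) (p : aw_param C).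
Local Notation q := (par_q p).

Definition theta_star (N : nat) : C := theta (dual_param p) N.

Definition eta_star : C := eta n (swap_bc p).

(* A*_{L,M}: the matrix entries of A* in the eigenbasis of A. *)
Definition Astar_entry (L M : nat) : C :=
  if L == M.+1 then Astar_up n p L
  else if M == L.+1 then Astar_down n p M
  else if L == M then theta_star 0 - Astar_down n p M.+1 - Astar_up n p M
  else 0.

(* Normalization of the Psi_- states. The factor of index k : 'I_n uses
   A*_{k+1,k}, as k starts at 0 here. *)
Definition norm_minus (w : 'I_n -> C) : C :=
  \prod_(k < n) (q * w k * bfun (w k ^+ 2) * Astar_entry k.+1 k)^-1.

End DualScalars.

Section EntriesOfA.
Variables (C : fieldType) (n : nat) (p : aw_param C).
Local Notation q := (par_q p).

(* A_{L,N}: the matrix entries of A in the eigenbasis of A*. *)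
Definition A_entry (L N : nat) : C := Astar_entry n (dual_param p) L N.

(* Normalization of the Psi_+ states. *)
Definition norm_plus (u : 'I_n -> C) : C :=
  \prod_(k < n)
    (- q^-1 * (u k)^-1 * bfun (u k ^+ 2) * A_entry k.+1 k)^-1.

End EntriesOfA.

Section LeonardPair.
Variables (C : fieldType) (V : vectType C).
Implicit Types X Y A As : 'End(V).

(* [X, Y]_t = t X Y - t^-1 Y X *)
Definition qcomm (t : C) X Y : 'End(V) :=
  t *: (X \o Y)%VF - t^-1 *: (Y \o X)%VF.

Definition irreducible_pair A As : Prop :=
  forall U : {vspace V}, (A @: U <= U)%VS -> (As @: U <= U)%VS ->
    U = 0%VS \/ U = fullv.

Variables (n : nat) (p : aw_param C).
Local Notation q := (par_q p).

(* th M and ths N are the eigenvectors |theta_M> and |theta*_N>. *)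
Record leonard_pair A As (th ths : 'I_n.+1 -> V) : Prop := LeonardPair {
  dim_rep : \dim {:V} = n.+1;
  basis_th : basis_of fullv [tuple th M | M < n.+1];
  basis_ths : basis_of fullv [tuple ths N | N < n.+1];
  A_th : forall M : 'I_n.+1, A (th M) = theta p M *: th M;
  As_ths : forall N : 'I_n.+1, As (ths N) = theta_star p N *: ths N;
  theta_inj : injective (fun M : 'I_n.+1 => theta p M);
  theta_star_inj : injective (fun N : 'I_n.+1 => theta_star p N);
  A_As_irreducible : irreducible_pair A As;
  aw_relation : qcomm q^-1 A (qcomm q A As) =
    rho p *: As + omega n p *: A + eta n p *: \1%VF;
  aw_relation_star : qcomm q^-1 As (qcomm q As A) =
    rho p *: A + omega n p *: As + eta_star n p *: \1%VF;
  As_th : forall M : 'I_n.+1,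
    As (th M) = \sum_(L < n.+1) Astar_entry n p L M *: th L;
  A_ths : forall N : 'I_n.+1,
    A (ths N) = \sum_(L < n.+1) A_entry n p L N *: ths L;
  ths0E : ths ord0 = \sum_(M < n.+1) th M }.

Definition is_transition (th ths : 'I_n.+1 -> V) (P : 'M[C]_n.+1) : Prop :=
  forall N : 'I_n.+1, ths N = \sum_(M < n.+1) P M N *: th M.

Definition Bop A As (chi u : C) : 'End(V) :=
  (chi * bfun (u ^+ 2)) *:
  ((rho p)^-1 *: (qcomm q As A + (omega n p / (q - q^-1)) *: \1%VF)
   + ((q * u ^+ 2 + q^-1 * u ^- 2) / (q ^ 2 - q ^ (-2))) *: \1%VF).

Definition B_minus A As (chi alpha u : C) (m : int) : 'End(V) :=
  (alpha^-1 * q ^ (m + 2) * u) *: Bop A As chi u.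

Definition B_plus A As (chi alpha u : C) (m : int) : 'End(V) :=
  (alpha^-1 * q ^ (- m - 2) * u^-1) *: Bop A As chi u.

(* The products are ordered with the factor of index 0 leftmost. With
   i = k - 1 the second argument is m0 + 2 (2s - k), k = 1, ..., 2s. *)
Definition Psi_minus A As (chi alpha : C) (m0 : int) (w : 'I_n -> C)
    (Omega : V) : V :=
  (\big[@comp_lfun C V V V / \1%VF]_(i < n)
     B_minus A As chi alpha (w i) (m0 + 2 * (n%:Z - i.+1%:Z))) Omega.

Definition Psi_plus A As (chi alpha : C) (m0 : int) (u : 'I_n -> C)
    (Omega : V) : V :=
  (\big[@comp_lfun C V V V / \1%VF]_(i < n)
     B_plus A As chi alpha (u i) (m0 + 2 * (n%:Z - i.+1%:Z))) Omega.

End LeonardPair.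

(* Main.v *)
(* Up to an affine change, [A*, A]_q is a third operator Y which forms with A
   and A* a cyclically symmetric triple of q-commutator relations, and the
   Bethe operator B(u) is a multiple of x - Y with x = z + 1/z, z = q u^2. A
   Bethe state is thus p(Y) applied to the reference state v, where p has the
   roots x_i attached to the Bethe roots u_i. The relations turn the action of
   A on polynomials in Y into a q-difference operator D, so that A p(Y) v =
   (D p)(Y) v, where D raises the degree by one. Moreover chi(Y) v = 0 for
   chi = prod_k (X - chi_k), chi_k = zeta^2 q^(2k-n) + its inverse. The Bethe
   equations say that D p minus a multiple of chi vanishes at the n roots of
   p; the two leading coefficients match those of theta p, hence
   D p = theta p + const chi and A p(Y) v = theta p(Y) v. Normalization is read
   off the top coordinate in the eigenbasis of A*, along which Y is tridiagonal.
   The statement for A* follows by exchanging A and A* and inverting q, zeta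
   and all Bethe roots. *)

From HB Require Import structures.
Require Import Defs.
From mathcomp Require Import all_boot all_order all_algebra.
From mathcomp Require Import complex reals.
From mathcomp Require Import ring zify.

Set Implicit Arguments.
Unset Strict Implicit.
Unset Printing Implicit Defensive.

Import GRing.Theory.
Local Open Scope ring_scope.

Lemma sqrD1_neq0 (C : fieldType) (q : C) : q ^+ 4 != 1 -> q * q + 1 != 0.
Proof.
move=> q4; apply: contra_neq q4 => h; apply/eqP; rewrite -subr_eq0.
by rewrite (_ : _ - 1 = (q * q + 1) * (q * q - 1)); [rewrite h mul0r|ring].
Qed.

(** * Rational identities, with T standing for q^(2s) and K for q^(2k) *)

Section ScalarIdentities.
Variables (C : fieldType) (q b bs cs zeta T : C).
Hypotheses (q0 : q != 0) (b0 : b != 0) (bs0 : bs != 0) (cs0 : cs != 0).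
Hypotheses (zeta0 : zeta != 0) (T0 : T != 0) (q4 : q ^+ 4 != 1).
Let c := bs * cs / b.
Let kap := q ^+ 2 - q ^- 2.
Let zz := zeta ^+ 2 + zeta ^- 2.

Let qq1 : q * q - 1 != 0.
Proof.
by apply: contra_neq q4 => h; rewrite (exprM q 2 2) (expr2 q) (subr0_eq h) expr1n.
Qed.

Let qq2 : q * q + 1 != 0.
Proof. exact: (sqrD1_neq0 q4). Qed.

Let q41 : (q * q) ^+ 2 - 1 != 0.
Proof. by rewrite -expr2 -exprM subr_eq0. Qed.

Ltac nz := repeat (apply/andP; split); rewrite ?oner_neq0 //.

Definition eta_quot := (q + q^-1)^-1 *
  ((b * T + c / T) * zz - (bs * T + cs / T) * (T * q + (T * q)^-1)).
Definition etas_quot := (q + q^-1)^-1 *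
  ((bs * T + cs / T) * zz - (b * T + c / T) * (T * q + (T * q)^-1)).
Definition omega_red :=
  b * c * zz * (T * q + (T * q)^-1) - (b * T + c / T) * (bs * T + cs / T).
Definition A_diag_first := b + c -
  (1 - T ^- 2) * (cs - bs) * (cs + b * zeta ^+ 2 * q * T) *
  (c + bs * zeta ^- 2 * q * T) / ((cs - bs) * (cs - bs * q ^+ 2)).
Definition A_shift := b * T ^+ 2 + c - cs * zz / (q * T).

(** The denominators of A_00 cancel here, which leaves the constant term of A v = c* q^-1 Y v +
    [A_shift] v at v = |theta*_0>. *)
Lemma A_shiftE : cs - bs != 0 -> cs - bs * q ^+ 2 != 0 ->
  A_diag_first - ((q - q^-1) * omega_red + (q - q^-1) * (bs + cs) * A_diag_first)
        / (bs * q * kap) = A_shift.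
Proof.
move=> h1 h2; rewrite /A_diag_first /omega_red /A_shift /zz /kap /c.
by field; nz.
Qed.

(** Weight of the shift z -> q^2 z in the q-difference operator; the shift z -> q^-2 z carries the
    value at 1/z. At z = q u^2 these two values are Lambda_2 and Lambda_1 (epsilon = 1) up to
    elementary factors. *)
Definition qdiff_weight (z : C) := (q - q^-1) / (q ^+ 2 * T) / z ^+ 3 / (z - z^-1) *
  (T * zeta - z / zeta) * (T / zeta - z * zeta) *
  (q * T * b * z + cs / T) * (q * z * bs / b + 1).

(** When A is moved past a factor Y, the coefficients of p(x) at x = z + 1/z balance exactly under
    this condition on the weights. The next lemma is the same condition for A*. *)
Lemma qdiff_weight_sum (z : C) : z != 0 -> z * z - 1 != 0 ->
  qdiff_weight z + qdiff_weight z^-1 = kap / q * (bs + cs + eta_quot)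
    - (1 - q ^- 2) * (z + z^-1) * (cs / q * (z + z^-1) + A_shift).
Proof.
move=> z0 z1; rewrite /qdiff_weight /eta_quot /A_shift /zz /kap /c.
have z2 : 1 + - z * z != 0 by rewrite mulNr -opprB oppr_eq0.
by field; nz.
Qed.

Lemma qdiff_weight_dual_sum (z : C) : z != 0 -> z * z - 1 != 0 ->
  q * z * qdiff_weight z + q / z * qdiff_weight z^-1 = - (bs + cs) * (z + z^-1) * (1 - q ^+ 2)
    - kap * q * (cs / q * (z + z^-1) + A_shift + etas_quot).
Proof.
move=> z0 z1; rewrite /qdiff_weight /etas_quot /A_shift /zz /kap /c.
have z2 : 1 + - z * z != 0 by rewrite mulNr -opprB oppr_eq0.
by field; nz.
Qed.

(** Data of the Newton basis N_k = prod_(j < k) (X - chi_j), in which Y is lower and A* upper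
    bidiagonal: A* N_k = theta*_k N_k + phi_k N_(k-1) and A N_k = a_k N_(k+1) + g_k N_k + h_k
    N_(k-1). At K = q^(2k), [spec_at] is chi_k, [dual_eig] is theta*_k, and [raise_at], [diag_at],
    [split_at], [lower_at] are a_k, g_k, phi_k, h_k. *)
Definition spec_at (K : C) := zeta ^+ 2 / T * K + (zeta ^+ 2 / T * K)^-1.
Definition dual_eig (K : C) := bs * K + cs / K.
Definition raise_at (K : C) := cs / q / K.
Definition diag_at (K : C) := (A_shift + cs / q * spec_at 1
  - cs * T / zeta ^+ 2 * (q + q^-1) * (1 - K^-1)) / K.
Definition split_at (K : C) := q ^+ 2 / zeta ^+ 2 * T / K ^+ 2 * (1 - K) *
  (1 - K / (T ^+ 2 * q ^+ 2)) * (cs + b * T * K * zeta ^+ 2 / q) *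
  (1 + bs / b * zeta ^+ 2 * K / (T * q)).
Definition lower_at (K : C) := split_at K * q * T / zeta ^+ 2 / K.

(** The identities from here to [lower_at_rec] come from comparing Newton coefficients when A or A*
    is moved past X - chi_k; they feed [As_A_newton]. *)
Lemma diag_at_rec (K : C) : K != 0 ->
  diag_at (q ^+ 2 * K) = q ^- 2 * (raise_at K * spec_at (q ^+ 2 * K) + diag_at K) - spec_at K * raise_at K.
Proof. by move=> K0; rewrite /diag_at /raise_at /spec_at /A_shift /zz /c; field; nz. Qed.

Lemma raise_at_rec (K : C) : K != 0 -> raise_at (q ^+ 2 * K) = q ^- 2 * raise_at K.
Proof. by move=> K0; rewrite /raise_at; field; nz. Qed.

Lemma dual_eig_rec (K : C) : K != 0 ->
  dual_eig (q ^+ 2 * K) = q ^+ 2 * dual_eig K - kap * q * raise_at K.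
Proof. by move=> K0; rewrite /raise_at /dual_eig /kap; field; nz. Qed.

Lemma split_at_rec (K : C) : K != 0 ->
  split_at (q ^+ 2 * K) = q ^+ 2 * (dual_eig K * spec_at K + split_at K)
    - kap * q * (diag_at K + etas_quot) - spec_at K * dual_eig K.
Proof.
move=> K0; rewrite /split_at /diag_at /dual_eig /spec_at /etas_quot /kap /A_shift /zz /c.
by field; nz.
Qed.

Lemma split_lower_at (K : C) : K != 0 ->
  q ^+ 2 * split_at (q ^+ 2 * K) * spec_at K - kap * q * lower_at (q ^+ 2 * K)
  - spec_at (q ^+ 2 * K) * split_at (q ^+ 2 * K) = 0.
Proof. by move=> K0; rewrite /lower_at /kap /spec_at; move: (split_at _) => P; field; nz. Qed.

Lemma lower_split_at (K : C) : K != 0 ->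
  q ^- 2 * lower_at (q ^+ 2 * K) * spec_at K + kap / q * split_at (q ^+ 2 * K)
  - spec_at (q ^+ 2 * K) * lower_at (q ^+ 2 * K) = 0.
Proof. by move=> K0; rewrite /lower_at /kap /spec_at; move: (split_at _) => P; field; nz. Qed.

Lemma lower_at_rec (K : C) : K != 0 ->
  lower_at (q ^+ 2 * K) = q ^- 2 * (diag_at K * spec_at K + lower_at K)
    + kap / q * (dual_eig K + eta_quot) - spec_at K * diag_at K.
Proof.
move=> K0; rewrite /lower_at /split_at /diag_at /dual_eig /spec_at /eta_quot /kap /A_shift /zz /c.
by field; nz.
Qed.

(** The factor 1 - K / (q T)^2 vanishes at k = 2s + 1, so phi_(2s+1) = 0 and the Newton basis is cut
    off there. *)
Lemma split_at_last : split_at (q ^+ 2 * T ^+ 2) = 0.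
Proof. by rewrite /split_at; field; nz. Qed.

Definition A_diag_last := b + c -
  q ^+ 2 / T ^+ 2 * (1 - T ^+ 2) * (cs - bs * T ^+ 4) *
  (b * T / q * zeta ^+ 2 + bs * T ^+ 2 / q ^+ 2) *
  (cs * T / q * zeta ^- 2 + c * T ^+ 2 / q ^+ 2) /
  ((cs - bs * T ^+ 4 / q ^+ 2) * (cs - bs * T ^+ 4)).

(** With n = 2s this reads Y_nn = chi_n + phi_n / (theta*_n - theta*_(n-1)), the identity that makes
    the last coordinate of chi(Y) v vanish. *)
Lemma Y_diag_last : cs - bs * T ^+ 4 != 0 -> cs * q ^+ 2 - bs * T ^+ 4 != 0 ->
  (bs * cs * kap)^-1 *
    ((q - q^-1) * dual_eig (T ^+ 2) * A_diag_last + (q - q^-1) * omega_red) =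
  spec_at (T ^+ 2) + split_at (T ^+ 2) / (dual_eig (T ^+ 2) - dual_eig (T ^+ 2 / q ^+ 2)).
Proof.
move=> h1 h2.
have -> : dual_eig (T ^+ 2) - dual_eig (T ^+ 2 / q ^+ 2) =
    - (q * q - 1) * (cs * q ^+ 2 - bs * T ^+ 4) / (q * T) ^+ 2.
  by rewrite /dual_eig; field; nz.
rewrite /A_diag_last /omega_red /spec_at /split_at /dual_eig /kap /zz /c.
by field; nz; rewrite oppr_eq0.
Qed.

End ScalarIdentities.

(** * Divided differences and products of linear factors *)

Section DividedDifference.
Variable C : fieldType.
Implicit Types (p g : {poly C}) (x y : C).

(** This is (p(y) - p(x)) / (y - x), as a polynomial quotient so that it keeps its meaning at y = x.
    A q-shift can fix a point: q^2 z + 1/(q^2 z) = z + 1/z when z^2 = q^-2. *)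
Definition ddiff p x y := (p %/ ('X - x%:P)).[y].

Lemma ddiff_factor g x y : ddiff (('X - x%:P) * g) x y = g.[y].
Proof. by rewrite /ddiff mulrC mulpK // polyXsubC_eq0. Qed.

Lemma ddiffC a x y : ddiff a%:P x y = 0.
Proof. by rewrite /ddiff divp_small ?hornerC // size_XsubC size_polyC ltnS leq_b1. Qed.

Lemma ddiff_MXaddC p a x y :
  ddiff (p * 'X + a%:P) x y = ddiff p x y * y + p.[x].
Proof.
rewrite /ddiff.
have -> : p * 'X + a%:P =
    (p %/ ('X - x%:P) * 'X + p.[x]%:P) * ('X - x%:P) + (p.[x] * x + a)%:P.
  rewrite {1}(divp_eq p ('X - x%:P)) modp_XsubC rmorphD rmorphM /=; ring.
by rewrite divp_addl_mul_small ?hornerE // size_XsubC size_polyC ltnS leq_b1.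
Qed.

End DividedDifference.

Section OrdProducts.
Variables (C : fieldType) (m : nat) (F : 'I_m -> C).

Lemma size_prodX_ord : size (\prod_(i < m) ('X - (F i)%:P)) = m.+1.
Proof. by rewrite size_prod_XsubC [index_enum _]unlock -enumT size_enum_ord. Qed.

Lemma lead_prodX_ord : (\prod_(i < m) ('X - (F i)%:P))`_m = 1.
Proof.
have /monicP := monic_prod_XsubC (index_enum 'I_m) xpredT F.
by rewrite lead_coefE size_prodX_ord.
Qed.

Lemma sublead_prodX_ord : (0 < m)%N ->
  (\prod_(i < m) ('X - (F i)%:P))`_m.-1 = - \sum_(i < m) F i.
Proof.
have := coefPn_prod_XsubC (ps := map F (index_enum 'I_m)).
rewrite (_ : size _ = m) ?big_map -?lt0n //; last first.
  by rewrite size_map [index_enum _]unlock -enumT size_enum_ord.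
Qed.

End OrdProducts.

(** * Polynomials in Y applied to a vector *)

Section PolynomialAction.
Variables (C : fieldType) (V : vectType C) (Y : 'End(V)) (v : V).
Implicit Types p r : {poly C}.

Definition pact p : V := \sum_(i < size p) p`_i *: iter i Y v.

Lemma pact_wide m p : (size p <= m)%N ->
  pact p = \sum_(i < m) p`_i *: iter i Y v.
Proof.
move=> pm; rewrite /pact (big_ord_widen m (fun i => p`_i *: iter i Y v) pm).
rewrite big_mkcond; apply: eq_bigr => i _; case: ltnP => // /leq_sizeP ->//.
by rewrite scale0r.
Qed.

Fact pact_is_linear : linear pact.
Proof.
move=> a p r; set m := maxn (size p) (size r).
have sp : (size p <= m)%N by apply: leq_maxl.
have sr : (size r <= m)%N by apply: leq_maxr.
have spr : (size (a *: p + r)%R <= m)%N.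
  by rewrite (leq_trans (size_polyD _ _)) // geq_max sr (leq_trans (size_scale_leq a p)).
rewrite !(pact_wide sp, pact_wide sr, pact_wide spr) scaler_sumr -big_split /=.
by apply: eq_bigr => i _; rewrite coefD coefZ scalerDl scalerA.
Qed.
HB.instance Definition _ :=
  GRing.isLinear.Build C {poly C} V _ pact pact_is_linear.

Lemma pactD p r : pact (p + r) = pact p + pact r. Proof. exact: linearD. Qed.
Lemma pactB p r : pact (p - r) = pact p - pact r. Proof. exact: linearB. Qed.
Lemma pactZ a p : pact (a *: p) = a *: pact p. Proof. exact: linearZ. Qed.

Lemma pactC a : pact a%:P = a *: v.
Proof. by rewrite (@pact_wide 1) ?size_polyC ?leq_b1 // big_ord1 coefC. Qed.

Lemma pactMX p : pact (p * 'X) = Y (pact p).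
Proof.
rewrite (@pact_wide (size p).+1) ; last first.
  by rewrite (leq_trans (size_polyMleq _ _)) // size_polyX addn2.
rewrite big_ord_recl coefMX eqxx scale0r add0r linear_sum.
by apply: eq_bigr => i _; rewrite coefMX linearZ.
Qed.

Lemma pactX : pact 'X = Y v.
Proof. by rewrite -['X]mul1r pactMX -polyC1 pactC scale1r. Qed.

Lemma pactMXC p x : pact (p * ('X - x%:P)) = Y (pact p) - x *: pact p.
Proof. by rewrite mulrBr pactB pactMX mulrC mul_polyC pactZ. Qed.

End PolynomialAction.

(** * The action of A and A* on polynomials in Y *)

Section AskeyWilsonAction.
Variables (C : fieldType) (V : vectType C) (A As Y : 'End(V)) (v : V).
Variables (q ha has ts0 al be : C) (W : C -> C).
Let kap := q ^+ 2 - q ^- 2.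
Hypothesis q0 : q != 0.
Hypothesis A_Y : forall w : V,
  A (Y w) = q ^- 2 *: Y (A w) + (kap / q) *: (As w + ha *: w).
Hypothesis As_Y : forall w : V,
  As (Y w) = q ^+ 2 *: Y (As w) - (kap * q) *: (A w + has *: w).
Hypothesis As_v : As v = ts0 *: v.
Hypothesis A_v : A v = al *: Y v + be *: v.
Hypothesis W_sum : forall z : C, z != 0 -> z * z - 1 != 0 ->
  W z + W z^-1 = kap / q * (ts0 + ha)
     - (1 - q ^- 2) * (z + z^-1) * (al * (z + z^-1) + be).
Hypothesis Ws_sum : forall z : C, z != 0 -> z * z - 1 != 0 ->
  q * z * W z + q / z * W z^-1 = - ts0 * (z + z^-1) * (1 - q ^+ 2)
     - kap * q * (al * (z + z^-1) + be + has).
Implicit Types (p D Ds : {poly C}).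

Lemma A_pactMX p D Ds :
  A (pact Y v p) = pact Y v D -> As (pact Y v p) = pact Y v Ds ->
  A (pact Y v (p * 'X)) =
    pact Y v (q ^- 2 *: (D * 'X) + (kap / q) *: (Ds + ha *: p)).
Proof.
move=> HD HDs; rewrite pactMX A_Y HD HDs 2!(pactD, pactZ).
by rewrite pactMX pactZ pactD pactZ.
Qed.

Lemma As_pactMX p D Ds :
  A (pact Y v p) = pact Y v D -> As (pact Y v p) = pact Y v Ds ->
  As (pact Y v (p * 'X)) =
    pact Y v (q ^+ 2 *: (Ds * 'X) - (kap * q) *: (D + has *: p)).
Proof.
move=> HD HDs; rewrite pactMX As_Y HD HDs pactB !pactZ.
by rewrite pactMX pactD pactZ.
Qed.

(** The weights are arguments because A and A* share this shape: W(z), W(1/z) for A, and these times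
    q z, q/z for A*. *)
Definition qdiff (p : {poly C}) (z w w' : C) :=
  w * ddiff p (z + z^-1) (q ^+ 2 * z + (q ^+ 2 * z)^-1)
  + w' * ddiff p (z + z^-1) (q ^- 2 * z + (q ^- 2 * z)^-1).

(** [D] and [Ds] represent A p(Y) v and A* p(Y) v. They are built together, since moving A past Y
    produces A* and conversely. [aw_image0] handles size p = 0, which the bounds stated with m.+1
    miss. *)
Record aw_image p D Ds : Prop := AWImage {
  A_pact : A (pact Y v p) = pact Y v D;
  As_pact : As (pact Y v p) = pact Y v Ds;
  horner_A : forall z : C, z != 0 -> z * z - 1 != 0 ->
    D.[z + z^-1] = (al * (z + z^-1) + be) * p.[z + z^-1]
                   + qdiff p z (W z) (W z^-1);
  horner_As : forall z : C, z != 0 -> z * z - 1 != 0 ->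
    Ds.[z + z^-1] = ts0 * p.[z + z^-1]
                   + qdiff p z (q * z * W z) (q / z * W z^-1);
  aw_image0 : p = 0 -> D = 0 /\ Ds = 0;
  size_A : forall m, (size p <= m.+1 -> size D <= m.+2)%N;
  size_As : forall m, (size p <= m.+1 -> size Ds <= m.+1)%N;
  lead_A : forall m, (size p <= m.+1)%N ->
    D`_m.+1 = al * (q ^- 2) ^+ m * p`_m;
  sublead_A : forall m, (size p <= m.+1)%N ->
    D`_m = be * (q ^- 2) ^+ m * p`_m
           + al * (q ^- 2) ^+ m * q ^+ 2 * (p * 'X)`_m }.

(** Induction along p -> p X + c. The value p(x) and the two divided differences act as independent
    unknowns; their coefficients match thanks to [W_sum] and [Ws_sum]. *)
Lemma aw_image_ex p : exists D Ds, aw_image p D Ds.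
Proof.
elim/poly_ind: p => [|p c [D [Ds [HD HDs eD eDs D0 sD sDs lD slD]]]].
  exists 0, 0; split=> [||z z0 z1|z z0 z1||||m _|m _];
    rewrite ?linear0 ?size_poly0 ?mul0r ?coef0 ?mulr0 ?addr0 //.
  - by rewrite /qdiff -polyC0 !ddiffC !hornerC !mulr0 !addr0.
  - by rewrite /qdiff -polyC0 !ddiffC !hornerC !mulr0 !addr0.
exists (q ^- 2 *: (D * 'X) + (kap / q) *: (Ds + ha *: p) + c *: (al *: 'X + be%:P)).
exists (q ^+ 2 *: (Ds * 'X) - (kap * q) *: (D + has *: p) + (c * ts0)%:P).
have sizeX m : (size (p * 'X + c%:P)%R <= m.+1 -> size p <= m)%N.
  have [->|p0] := eqVneq p 0; first by rewrite size_poly0.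
  rewrite size_polyDl size_mulX // size_polyC.
  by apply: leq_ltn_trans (leq_b1 _) _; rewrite ltnS size_poly_gt0.
split.
- rewrite pactD [in RHS]pactD pactC linearD /= (A_pactMX HD HDs) [A (_ *: _)]linearZ /=.
  by congr (_ + _); rewrite A_v pactZ pactD pactZ pactC pactX.
- rewrite pactD [in RHS]pactD !pactC linearD /= (As_pactMX HD HDs) [As (_ *: _)]linearZ /=.
  by rewrite As_v scalerA.
- move=> z z0 z1; rewrite /qdiff !ddiff_MXaddC !hornerE eD // eDs //=.
  rewrite /qdiff; set d := ddiff _ _ _; set d' := ddiff _ _ _.
  (* With W(1/z) eliminated, the claim is a rational identity in z, W(z), p(x) and the divided
     differences. *)
  have -> : W z^-1 = kap / q * (ts0 + ha)
     - (1 - q ^- 2) * (z + z^-1) * (al * (z + z^-1) + be) - W z.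
    by rewrite -W_sum // addrC addKr.
  move: p.[_] (W z) => P w; rewrite /kap; field.
  by rewrite q0 z0.
- move=> z z0 z1; rewrite /qdiff !ddiff_MXaddC !hornerE eD // eDs //=.
  rewrite /qdiff; set d := ddiff _ _ _; set d' := ddiff _ _ _.
  have -> : W z^-1 = (- ts0 * (z + z^-1) * (1 - q ^+ 2)
     - kap * q * (al * (z + z^-1) + be + has) - q * z * W z) * (z / q).
    rewrite -Ws_sum // addrAC subrr add0r; field; by rewrite q0 z0.
  move: p.[_] (W z) => P w; rewrite /kap; field.
  by rewrite q0 z0.
- move=> pc0; have p0 : p = 0.
    by apply/polyP=> i; have := congr1 (fun r : {poly C} => r`_i.+1) pc0; rewrite coefD coefMX coefC !coef0 addr0.
  move: pc0; rewrite p0 mul0r add0r => /eqP; rewrite polyC_eq0 => /eqP ->.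
  by have [-> ->] := D0 p0; rewrite !(mul0r, scaler0, addr0, scale0r, subr0).
- move=> m /sizeX sp; apply/leq_sizeP => -[|[|j]] // mj.
  rewrite !(coefD, coefZ, coefMX, coefX, coefC) /=.
  case: m sp mj => [|m] sp mj.
    have := sp; rewrite leqn0 size_poly_eq0 => /eqP p0.
    by have [-> ->] := D0 p0; rewrite p0 !coef0; ring.
  rewrite (leq_sizeP _ _ (sD _ sp)) // (leq_sizeP _ _ (sDs _ sp)) ?(leq_sizeP _ _ sp) //.
  all: first [ring | exact: ltnW | exact: (ltnW (ltnW _)) | idtac].
- move=> m /sizeX sp; apply/leq_sizeP => -[|j] // mj.
  rewrite !(coefD, coefN, coefZ, coefMX, coefC) /=.
  case: m sp mj => [|m] sp mj.
    have := sp; rewrite leqn0 size_poly_eq0 => /eqP p0.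
    by have [-> ->] := D0 p0; rewrite p0 !coef0; ring.
  rewrite (leq_sizeP _ _ (sD _ sp)) // (leq_sizeP _ _ (sDs _ sp)) ?(leq_sizeP _ _ sp) //.
  all: first [ring | exact: ltnW | exact: (ltnW (ltnW _)) | idtac].
- move=> m /sizeX sp.
  rewrite !(coefD, coefZ, coefMX, coefX, coefC) /=.
  case: m sp => [|m] sp.
    have := sp; rewrite leqn0 size_poly_eq0 => /eqP p0.
    by have [-> ->] := D0 p0; rewrite p0 !coef0 /=; ring.
  (* The contributions of [Ds], [p] and the constant c lie in lower degree. *)
  rewrite lD // (leq_sizeP _ _ (sDs _ sp) m.+2) ?(leq_sizeP _ _ sp m.+2) //.
  by rewrite (exprS _ m) /=; ring.
- move=> m /sizeX sp.
  rewrite !(coefD, coefZ, coefMX, coefX, coefC) /=.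
  case: m sp => [|m] sp.
    have := sp; rewrite leqn0 size_poly_eq0 => /eqP p0.
    by have [-> ->] := D0 p0; rewrite p0 !coef0 /=; ring.
  rewrite slD // (leq_sizeP _ _ (sDs _ sp) m.+1) ?(leq_sizeP _ _ sp m.+1) // (exprS _ m) /=.
  rewrite coefMX; case: m sp => [|m] sp /=; field; by rewrite q0.
Qed.

Variables (chi th a g phi h : nat -> C).
Hypotheses (th0 : th 0 = ts0) (a0 : a 0 = al) (g0 : g 0 = be + al * chi 0)
  (phi0 : phi 0 = 0) (h0 : h 0 = 0).
Hypothesis raise_at_rec : forall k, a k.+1 = q ^- 2 * a k.
Hypothesis th_rec : forall k, th k.+1 = q ^+ 2 * th k - kap * q * a k.
Hypothesis diag_at_rec : forall k,
  g k.+1 = q ^- 2 * (a k * chi k.+1 + g k) - chi k * a k.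
Hypothesis split_at_rec : forall k,
  phi k.+1 = q ^+ 2 * (th k * chi k + phi k) - kap * q * (g k + has) - chi k * th k.
Hypothesis lower_at_rec : forall k,
  h k.+1 = q ^- 2 * (g k * chi k + h k) + kap / q * (th k + ha) - chi k * g k.
Hypothesis split_lower_at : forall k,
  q ^+ 2 * phi k.+1 * chi k - kap * q * h k.+1 - chi k.+1 * phi k.+1 = 0.
Hypothesis lower_split_at : forall k,
  q ^- 2 * h k.+1 * chi k + kap / q * phi k.+1 - chi k.+1 * h k.+1 = 0.

Definition newton (x : nat -> C) k : {poly C} := \prod_(j < k) ('X - (x j)%:P).

Lemma newtonS x k : newton x k.+1 = newton x k * ('X - (x k)%:P).
Proof. exact: big_ord_recr. Qed.

(** Both formulas go through one induction on N_(k+1) = N_k (X - chi_k). The recursions match all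
    coefficients except that of N_(k-1), which [split_lower_at] and [lower_split_at] make zero. *)
Lemma As_A_newton k :
  As (pact Y v (newton chi k)) =
    pact Y v (th k *: newton chi k + phi k *: newton chi k.-1) /\
  A (pact Y v (newton chi k)) =
    pact Y v (a k *: newton chi k.+1 + g k *: newton chi k + h k *: newton chi k.-1).
Proof.
elim: k => [|k [IHs IH]].
  rewrite newtonS /newton big_ord0 phi0 h0 !scale0r !addr0 mul1r.
  rewrite pactD !pactZ pactB !pactC pactX !scale1r As_v A_v th0 a0 g0.
  by split=> //; rewrite scalerBr scalerA scalerDl [be *: v + _ in RHS]addrC addrA subrK.
split.
  rewrite newtonS mulrBr pactB linearB /= (As_pactMX IH IHs) [_ * (chi k)%:P]mulrC mul_polyC pactZ.
  rewrite [As (_ *: _)]linearZ /= IHs -pactZ -pactB; congr (pact _ _ _).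
  rewrite th_rec split_at_rec -!mul_polyC; case: k {IH IHs} => [|k].
    rewrite phi0 h0 /= !(rmorphD, rmorphN, rmorphM, rmorphXn, newtonS) /=. ring.
  rewrite !newtonS /=. 
  (* The two sides differ by N_k times the left side of [split_lower_at]. *)
  apply/eqP; rewrite -subr_eq0 -[X in _ == X](mul0r (newton chi k)) -polyC0 -(split_lower_at k).
  rewrite  !(rmorphD, rmorphN, rmorphM) /=; apply/eqP. ring.
rewrite newtonS mulrBr pactB linearB /= (A_pactMX IH IHs) [_ * (chi k)%:P]mulrC mul_polyC pactZ.
rewrite [A (_ *: _)]linearZ /= IH -pactZ -pactB; congr (pact _ _ _).
rewrite raise_at_rec diag_at_rec lower_at_rec -!mul_polyC; case: k {IH IHs} => [|k].
  rewrite phi0 h0 /= !(rmorphD, rmorphN, rmorphM, newtonS) /=. ring.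
rewrite !newtonS /=. 
apply/eqP; rewrite -subr_eq0 -[X in _ == X](mul0r (newton chi k)) -polyC0 -(lower_split_at k).
rewrite  !(rmorphD, rmorphN, rmorphM) /=; apply/eqP. ring.
Qed.

End AskeyWilsonAction.

(** * Structure constants and matrix entries as rational expressions *)

Section IntegerPowers.
Variables (C : fieldType) (q : C).
Hypothesis q0 : q != 0.

Lemma expz2 (m : nat) : q ^ (2 * m%:Z) = (q ^+ 2) ^+ m.
Proof. by rewrite -exprz_exp. Qed.

Lemma expz4 (m : nat) : q ^ (4 * m%:Z) = ((q ^+ 2) ^+ m) ^+ 2.
Proof. by rewrite -exprz_exp -[LHS]/((q ^+ 4) ^+ m) (exprM q 2 2) exprAC. Qed.

End IntegerPowers.

Section Scalars.
Variables (C : fieldType) (n : nat) (p : aw_param C).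
Hypothesis p_generic : generic_param n p.
Local Notation q := (par_q p).
Local Notation b := (par_b p).
Local Notation c := (par_c p).
Local Notation bs := (par_bs p).
Local Notation cs := (par_cs p).
Local Notation zeta := (par_zeta p).
Local Notation T := (q ^+ n).
Let q0 : q != 0 := q_neq0 p_generic.

Lemma thetaE M : theta p M = b * (q ^+ 2) ^+ M + c / (q ^+ 2) ^+ M.
Proof. by rewrite /theta -invr_expz expz2. Qed.

Lemma Astar_upE M (K := (q ^+ 2) ^+ M) : Astar_up n p M =
  q ^+ 2 / T ^+ 2 * ((1 - K) * (c - b * (K * T ^+ 2)) * 
   (bs * (T / q) * zeta ^- 2 + b * (K / q ^+ 2)) * (c * (T / q) * zeta ^+ 2 + cs * (K / q ^+ 2)))
   / ((c - b * (K ^+ 2 / q ^+ 2)) * (c - b * K ^+ 2)).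
Proof.
rewrite /Astar_up.
rewrite !(expfzDr _ _ q0) -!invr_expz !expz2 !expz4 [(_ ^+ 2) ^+ n]exprAC //.
Qed.

Lemma Astar_downE M (K := (q ^+ 2) ^+ M) : Astar_down n p M =
  ((1 - K / T ^+ 2 / q ^+ 2) * (c - b * (K / q ^+ 2)) * 
   (c + bs * zeta ^- 2 * (K * T / q)) * (cs + b * zeta ^+ 2 * (K * T / q)))
   / ((c - b * (K ^+ 2 / q ^+ 4)) * (c - b * (K ^+ 2 / q ^+ 2))).
Proof.
rewrite /Astar_down !(expfzDr _ _ q0) -!invr_expz !expz2 !expz4 [(_ ^+ 2) ^+ n]exprAC.
by [].
Qed.

Let kap := q ^+ 2 - q ^- 2.

Lemma par_cE : c = bs * cs / b.
Proof. by rewrite -(bc_eq p_generic) mulrAC mulfV ?mul1r // (b_neq0 p_generic). Qed.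

Lemma q4_neq1 : q ^+ 4 != 1.
Proof. exact: (q_not_root_of_unity p_generic). Qed.

Let q2 : q * q - 1 != 0.
Proof. by rewrite subr_eq0 -expr2 (q_not_root_of_unity p_generic). Qed.

Let q2' : q * q + 1 != 0.
Proof. exact: (sqrD1_neq0 q4_neq1). Qed.

Let q4 : (q * q) ^+ 2 - 1 != 0.
Proof. by rewrite -expr2 -exprM subr_eq0 q4_neq1. Qed.

Let T0 : T != 0. Proof. exact: expf_neq0. Qed.

Ltac nz := repeat (apply/andP; split); rewrite ?oner_neq0
  ?(b_neq0 p_generic) ?(bs_neq0 p_generic) ?(cs_neq0 p_generic)
  ?(zeta_neq0 p_generic) //.

Lemma rhoE : rho p = - (b * c) * kap ^+ 2. Proof. by []. Qed.

Lemma kap_neq0 : kap != 0.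
Proof.
rewrite (_ : kap = (q * q + 1) * (q * q - 1) / q ^+ 2); last by rewrite /kap; field; nz.
by rewrite mulf_neq0 ?invr_eq0 ?expf_neq0 // mulf_neq0.
Qed.

Lemma rho_neq0 : rho p != 0.
Proof.
by rewrite rhoE mulf_neq0 ?oppr_eq0 ?mulf_neq0 ?expf_neq0 ?kap_neq0
  ?(b_neq0 p_generic) ?(c_neq0 p_generic).
Qed.

Lemma omegaE : omega n p / (q - q^-1) =
  (q - q^-1) * omega_red q b bs cs zeta T.
Proof.
rewrite /omega /omega_red !(expfzDr _ _ q0) -!invr_expz par_cE.
rewrite -[q ^ n]/(q ^+ n) -[q ^ 1]/q; by field; nz.
Qed.

Lemma etaE : eta n p / rho p = eta_quot q b bs cs zeta T.
Proof.
rewrite /eta /rho /eta_quot !(expfzDr _ _ q0) -!invr_expz par_cE.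
rewrite -[q ^ n]/(q ^+ n) -[q ^ 1]/q -[q ^ 2]/(q ^+ 2); by field; nz; rewrite oppr_eq0 mulf_neq0 //; nz.
Qed.

Lemma eta_starE : eta_star n p / rho p = etas_quot q b bs cs zeta T.
Proof.
rewrite /eta_star /eta /rho /etas_quot /= !(expfzDr _ _ q0) -!invr_expz par_cE.
rewrite -[q ^ n]/(q ^+ n) -[q ^ 1]/q -[q ^ 2]/(q ^+ 2); by field; nz; rewrite oppr_eq0 mulf_neq0 //; nz.
Qed.

End Scalars.

Section DualScalars.
Variables (C : fieldType) (n : nat) (p : aw_param C).
Hypothesis p_generic : generic_param n p.
Local Notation q := (par_q p).
Local Notation b := (par_b p).
Local Notation c := (par_c p).
Local Notation bs := (par_bs p).
Local Notation cs := (par_cs p).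
Local Notation zeta := (par_zeta p).
Local Notation T := (q ^+ n).
Let q0 : q != 0 := q_neq0 p_generic.

Lemma dual_generic : generic_param n (dual_param p).
Proof.
by case: p_generic => *; split; rewrite //= ?invr_eq0.
Qed.

Lemma theta_starE M : theta_star p M = dual_eig bs cs ((q ^+ 2) ^+ M).
Proof. by rewrite /theta_star thetaE. Qed.

Ltac nz := repeat (apply/andP; split); rewrite ?oner_neq0
  ?(b_neq0 p_generic) ?(bs_neq0 p_generic) ?(cs_neq0 p_generic)
  ?(zeta_neq0 p_generic) ?expf_neq0 //.

Hypothesis n_gt0 : (0 < n)%N.

Lemma csbs_neq0 : cs - bs != 0.
Proof. by have := bcs_generic p_generic (leq0n _); rewrite mulr1. Qed.

Lemma csbsq2_neq0 : cs - bs * q ^+ 2 != 0.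
Proof. by have := @bcs_generic _ _ _ p_generic 1; apply; rewrite muln_gt0. Qed.

Lemma csbsT4_neq0 : cs - bs * T ^+ 4 != 0.
Proof.
by have := bcs_generic p_generic (leqnn _); rewrite mulnA [(_ * n)%N]mulnC exprM.
Qed.

Lemma csbsT4q2_neq0 : cs * q ^+ 2 - bs * T ^+ 4 != 0.
Proof.
have k1 : (2 * n - 1 <= 2 * n)%N by apply: leq_subr.
apply: contra_neq (bcs_generic p_generic k1) => h.
apply: (mulIf (expf_neq0 2 q0)); rewrite mul0r mulrBl -mulrA -exprD -[RHS]h.
rewrite -exprM; congr (_ - _ * _ ^+ _).
by lia.
Qed.

Lemma A_entry00 : A_entry n p 0 0 = A_diag_first q b bs cs zeta T.
Proof.
rewrite /A_entry /Astar_entry /= /theta_star (Astar_downE dual_generic) (Astar_upE dual_generic).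
rewrite !thetaE /A_diag_first /= (par_cE p_generic) !expr0 !expr1.
rewrite subrr !(mul0r, mulr0) subr0.
by field; nz; rewrite ?csbs_neq0 ?csbsq2_neq0.
Qed.

Lemma A_entrynn : A_entry n p n n = A_diag_last q b bs cs zeta T.
Proof.
rewrite /A_entry /Astar_entry /= ltn_eqF // eqxx /theta_star (Astar_downE dual_generic) (Astar_upE dual_generic).
rewrite !thetaE /A_diag_last /= (par_cE p_generic) !expr0 exprS [(q ^+ 2) ^+ n]exprAC.
(* The entry A_(n,n+1) vanishes, so only A_(n,n-1) is subtracted from theta_0. *)
rewrite (_ : 1 - q ^+ 2 * T ^+ 2 / T ^+ 2 / q ^+ 2 = 0) ?(mul0r, subr0); last by field; nz.
by field; nz; rewrite ?csbsT4_neq0 ?csbsT4q2_neq0.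
Qed.

End DualScalars.

(** * q-commutators and the data of a single eigenbasis *)

Section QComm.
Variables (C : fieldType) (V : vectType C).
Implicit Types X Z : 'End(V).

Lemma qcommE (t : C) X Z w :
  qcomm t X Z w = t *: X (Z w) - t^-1 *: Z (X w).
Proof. by rewrite /qcomm add_lfunE opp_lfunE !scale_lfunE !comp_lfunE. Qed.

(** Coordinates separate vectors. Stating this for plain functions with their linearity rules turns
    a vector identity into a scalar one within reach of [ring] and [field]. *)
Lemma vec_eqP (x y : V) :
  (forall f : V -> C, (forall u w, f (u + w) = f u + f w) ->
    (forall a u, f (a *: u) = a * f u) -> (forall u, f (- u) = - f u) ->
    f x = f y) -> x = y.
Proof.
move=> fxy; rewrite (coord_vbasis (memvf x)) (coord_vbasis (memvf y)).
apply: eq_bigr => i _; congr (_ *: _).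
apply: (fxy (fun u => coord (vbasis fullv) i u)) => [u w|a u|u].
- exact: linearD.
- exact: linearZ.
- exact: linearN.
Qed.

Lemma lfunD X u w : X (u + w) = X u + X w. Proof. exact: linearD. Qed.
Lemma lfunN X u : X (- u) = - X u. Proof. exact: linearN. Qed.
Lemma lfunZ X a u : X (a *: u) = a *: X u. Proof. exact: linearZ. Qed.

End QComm.

(** The part of a Leonard pair that refers to one eigenbasis only. It is instantiated twice: with A,
    A* as given, and with the two operators exchanged under the parameters [inv_dual]. *)
Record bispectral (C : fieldType) (V : vectType C) (n : nat) (p : aw_param C)
    (A As : 'End(V)) (ths : 'I_n.+1 -> V) : Prop := Bispectral {
  bi_generic : generic_param n p;
  bi_basis : basis_of fullv [tuple ths N | N < n.+1];
  bi_As_ths : forall N : 'I_n.+1, As (ths N) = theta_star p N *: ths N;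
  bi_A_ths : forall N : 'I_n.+1,
    A (ths N) = \sum_(L < n.+1) A_entry n p L N *: ths L;
  bi_irreducible : irreducible_pair A As;
  bi_relation : qcomm (par_q p)^-1 A (qcomm (par_q p) A As) =
    rho p *: As + omega n p *: A + eta n p *: \1%VF;
  bi_relation_star : qcomm (par_q p)^-1 As (qcomm (par_q p) As A) =
    rho p *: A + omega n p *: As + eta_star n p *: \1%VF }.

Section BandEntries.
Variables (C : fieldType) (n : nat) (p : aw_param C).
Local Notation q := (par_q p).
Let kap := q ^+ 2 - q ^- 2.

Lemma A_entry_far L N : (N.+1 < L)%N -> A_entry n p L N = 0.
Proof.
move=> NL; rewrite /A_entry /Astar_entry (gtn_eqF NL).
by rewrite !ifF //; apply/negbTE; rewrite neq_ltn; apply/orP; [right|left]; lia.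
Qed.

(** Entries of Y in the eigenbasis of A*; as A* is diagonal there, [A*, A]_q rescales each entry of
    A separately. *)
Definition Y_entry (L N : nat) : C := - (kap / rho p) *
  ((q * theta_star p L - q^-1 * theta_star p N) * A_entry n p L N
   + (L == N)%:R * (omega n p / (q - q^-1))).

Lemma Y_entry_far L N : (N.+1 < L)%N -> Y_entry L N = 0.
Proof.
move=> NL; rewrite /Y_entry A_entry_far // (_ : L == N = false) ?mul0r ?mulr0 ?addr0 ?mulr0 //.
by rewrite gtn_eqF // ltnW.
Qed.

End BandEntries.

(** * The third operator Y *)

Section ThirdOperator.
Variables (C : fieldType) (V : vectType C) (n : nat) (p : aw_param C).
Variables (A As : 'End(V)) (ths : 'I_n.+1 -> V).
Hypothesis AAs : bispectral p A As ths.
Local Notation q := (par_q p).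
Local Notation b := (par_b p).
Local Notation bs := (par_bs p).
Local Notation cs := (par_cs p).
Local Notation zeta := (par_zeta p).
Local Notation T := (q ^+ n).
Let p_generic := bi_generic AAs.
Let q0 : q != 0 := q_neq0 p_generic.
Let b0 : b != 0 := b_neq0 p_generic.
Let bs0 : bs != 0 := bs_neq0 p_generic.
Let cs0 : cs != 0 := cs_neq0 p_generic.
Let zeta0 : zeta != 0 := zeta_neq0 p_generic.
Let q4 : q ^+ 4 != 1 := q4_neq1 p_generic.
Let T0 : T != 0 := expf_neq0 n q0.
Let kap := q ^+ 2 - q ^- 2.

(** The shift by omega absorbs the terms omega A and omega A* of the Askey-Wilson relations. The
    scale makes the Bethe operator B(u) a scalar multiple of Y - x with x = q u^2 + 1/(q u^2). *)
Definition Yop : 'End(V) :=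
  - (kap / rho p) *: (qcomm q As A + (omega n p / (q - q^-1)) *: \1%VF).

Lemma YopE w : Yop w = - (kap / rho p) *:
  (q *: As (A w) - q^-1 *: A (As w) + (omega n p / (q - q^-1)) *: w).
Proof. by rewrite /Yop scale_lfunE add_lfunE scale_lfunE id_lfunE qcommE. Qed.

Let q2 : q * q - 1 != 0.
Proof. by rewrite -expr2 subr_eq0 (q_not_root_of_unity p_generic). Qed.

Lemma A_Yop w : A (Yop w) =
  q ^- 2 *: Yop (A w) + (kap / q) *: (As w + (eta n p / rho p) *: w).
Proof.
rewrite !YopE; have /lfunP/(_ w) := bi_relation AAs.
rewrite !qcommE !add_lfunE !scale_lfunE id_lfunE => E.
(* Solving the Askey-Wilson relation for its eta term leaves an identity linear in words in A and A*
   applied to w. *)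
have -> : (eta n p / rho p) *: w = (rho p)^-1 *: (
   q^-1 *: A (q *: A (As w) - q^-1 *: As (A w)) -
        q^-1^-1 *: (q *: A (As (A w)) - q^-1 *: As (A (A w)))
   - omega n p *: A w - rho p *: As w).
  rewrite E; apply: vec_eqP => f fD fZ fN; rewrite !(fD, fN, fZ).
  by field; rewrite (rho_neq0 p_generic).
apply: vec_eqP => f fD fZ fN; rewrite !(lfunD, lfunN, lfunZ, fD, fN, fZ) /kap.
by field; rewrite (rho_neq0 p_generic) q0 oner_neq0.
Qed.

Lemma As_Yop w : As (Yop w) =
  q ^+ 2 *: Yop (As w) - (kap * q) *: (A w + (eta_star n p / rho p) *: w).
Proof.
rewrite !YopE; have /lfunP/(_ w) := bi_relation_star AAs.
rewrite !qcommE !add_lfunE !scale_lfunE id_lfunE => E.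
have -> : (eta_star n p / rho p) *: w = (rho p)^-1 *: (
   q^-1 *: As (q *: As (A w) - q^-1 *: A (As w)) -
        q^-1^-1 *: (q *: As (A (As w)) - q^-1 *: A (As (As w)))
   - omega n p *: As w - rho p *: A w).
  rewrite E; apply: vec_eqP => f fD fZ fN; rewrite !(fD, fN, fZ).
  by field; rewrite (rho_neq0 p_generic).
apply: vec_eqP => f fD fZ fN; rewrite !(lfunD, lfunN, lfunZ, fD, fN, fZ) /kap.
by field; rewrite (rho_neq0 p_generic) q0 oner_neq0.
Qed.

Hypothesis n_gt0 : (0 < n)%N.

(** The vector r = A v - A_00 v is a multiple of |theta*_1>, so Y v is a combination of r and v;
    eliminating r expresses A v through Y v and v. *)
Lemma A_ths0 : A (ths ord0) = (cs / q) *: Yop (ths ord0)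
  + A_shift q b bs cs zeta T *: ths ord0.
Proof.
pose r := A (ths ord0) - A_entry n p 0 0 *: ths ord0.
have Ar : A (ths ord0) = r + A_entry n p 0 0 *: ths ord0 by rewrite subrK.
have Asr : As r = theta_star p 1 *: r.
  have -> : r = \sum_(L < n) A_entry n p L.+1 0 *: ths (lift ord0 L).
    by rewrite /r (bi_A_ths AAs) big_ord_recl addrC addKr.
  rewrite linear_sum scaler_sumr; apply: eq_bigr => -[[|L] lL] _ /=.
    by rewrite lfunZ (bi_As_ths AAs) /= scalerA mulrC scalerA.
  by rewrite A_entry_far // !scale0r linear0 scaler0.
move: r Ar Asr => r Ar Asr.
rewrite YopE (bi_As_ths AAs) lfunZ Ar !(lfunD, lfunZ) Asr (bi_As_ths AAs) /=.
rewrite -A_shiftE ?(csbs_neq0 p_generic) ?(csbsq2_neq0 p_generic n_gt0) //.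
rewrite (omegaE p_generic) rhoE !theta_starE /dual_eig -(A_entry00 p_generic n_gt0).
have k0 := kap_neq0 p_generic.
have c0 := cs_neq0 p_generic.
apply: vec_eqP => f fD fZ fN; rewrite !(fD, fN, fZ) (par_cE p_generic).
move: (A_entry n p 0 0) (omega_red _ _ _ _ _ _) (f r) (f (ths ord0)) => a om fr fv.
rewrite expr0 expr1 /kap; field.
by rewrite q0 -expr2 -exprM subr_eq0 q4 bs0 b0 oner_neq0 oppr_eq0 mulf_neq0.
Qed.

Lemma Yop_ths N : Yop (ths N) = \sum_(L < n.+1) Y_entry n p L N *: ths L.
Proof.
rewrite YopE (bi_As_ths AAs) lfunZ (bi_A_ths AAs) linear_sum !scaler_sumr.
rewrite -sumrB [X in _ + X](_ : _ = \sum_(L < n.+1) ((L == N)%:R * (omega n p / (q - q^-1))) *: ths L); last first.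
  rewrite (bigD1 N) //= eqxx mul1r big1 ?addr0 // => i /negbTE ->.
  by rewrite mul0r scale0r.
rewrite -big_split /= scaler_sumr; apply: eq_bigr => L _.
rewrite lfunZ (bi_As_ths AAs) /Y_entry /kap.
apply: vec_eqP => f fD fZ fN; rewrite !(fD, fN, fZ).
by ring.
Qed.

(** In q theta*_(N+1) - q^-1 theta*_N the two c* terms cancel, which leaves a monomial factor. *)
Lemma Y_entry_sub N : Y_entry n p N.+1 N = q * (q ^+ 2) ^+ N / cs * A_entry n p N.+1 N.
Proof.
rewrite /Y_entry gtn_eqF // mul0r addr0 rhoE !theta_starE /dual_eig (exprS _ N) /kap.
have := expf_neq0 N (expf_neq0 2 q0); move: (_ ^+ N) => K K0.
rewrite (par_cE p_generic) /kap; field.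
by rewrite cs0 K0 q0 b0 -expr2 -exprM subr_eq0 q4 oppr_eq0 mulf_neq0.
Qed.

Lemma Y_entry_last : Y_entry n p n n = spec_at zeta T (T ^+ 2) +
   split_at q b bs cs zeta T (T ^+ 2) / (dual_eig bs cs (T ^+ 2) - dual_eig bs cs (T ^+ 2 / q ^+ 2)).
Proof.
rewrite -Y_diag_last ?(csbsT4_neq0 p_generic) ?(csbsT4q2_neq0 p_generic n_gt0) //.
rewrite /Y_entry (A_entrynn p_generic n_gt0) (omegaE p_generic) rhoE theta_starE.
rewrite [(q ^+ 2) ^+ n]exprAC eqxx mul1r (bc_eq p_generic).
move: (dual_eig _ _ _) (A_diag_last _ _ _ _ _ _) (omega_red _ _ _ _ _ _) => t a om.
rewrite /kap; field.
by rewrite q0 cs0 bs0 -expr2 -exprM subr_eq0 q4 oppr_eq0 mulf_neq0.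
Qed.

End ThirdOperator.

(** * The polynomial in Y that annihilates |theta*_0> *)

Section Spectrum.
Variables (C : fieldType) (V : vectType C) (n : nat) (p : aw_param C).
Variables (A As : 'End(V)) (ths : 'I_n.+1 -> V).
Hypothesis AAs : bispectral p A As ths.
Hypothesis n_gt0 : (0 < n)%N.
Local Notation q := (par_q p).
Local Notation b := (par_b p).
Local Notation bs := (par_bs p).
Local Notation cs := (par_cs p).
Local Notation zeta := (par_zeta p).
Local Notation T := (q ^+ n).
Local Notation Y := (Yop n p A As).
Local Notation v := (ths ord0).
Let p_generic := bi_generic AAs.
Let q0 : q != 0 := q_neq0 p_generic.
Let b0 : b != 0 := b_neq0 p_generic.
Let bs0 : bs != 0 := bs_neq0 p_generic.
Let cs0 : cs != 0 := cs_neq0 p_generic.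
Let zeta0 : zeta != 0 := zeta_neq0 p_generic.
Let q4 : q ^+ 4 != 1 := q4_neq1 p_generic.
Let T0 : T != 0 := expf_neq0 n q0.
Let K0 k : (q ^+ 2) ^+ k != 0 := expf_neq0 k (expf_neq0 2 q0).

Definition spec k : C := spec_at zeta T ((q ^+ 2) ^+ k).
Definition split_coef k : C := split_at q b bs cs zeta T ((q ^+ 2) ^+ k).

Lemma As_newton_spec k : As (pact Y v (newton spec k)) =
  theta_star p k *: pact Y v (newton spec k)
  + split_coef k *: pact Y v (newton spec k.-1).
Proof.
have AY := A_Yop AAs; have AsY := As_Yop AAs.
rewrite (etaE p_generic) in AY; rewrite (eta_starE p_generic) in AsY.
pose onK (f : C -> C) k := f ((q ^+ 2) ^+ k).
have th0 : As v = (bs + cs) *: v.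
  rewrite (bi_As_ths AAs) theta_starE /dual_eig /=. by rewrite expr0 invr1 !mulr1.
have [|||||k'|k'|k'|k'|k'|k'|k'|-> _] := As_A_newton AY AsY th0 (A_ths0 AAs n_gt0)
  (chi := spec) (th := onK (dual_eig bs cs)) (a := onK (raise_at q cs))
  (g := onK (diag_at q b bs cs zeta T)) (phi := split_coef)
  (h := onK (lower_at q b bs cs zeta T)) _ _ _ _ _ _ _ _ _ _ _ _ k.
- by rewrite /onK /dual_eig expr0 invr1 !mulr1.
- by rewrite /onK /raise_at expr0 divr1.
- by rewrite /onK /diag_at /spec !expr0 invr1 subrr mulr0 subr0 mulr1.
- by rewrite /split_coef /split_at subrr !(mulr0, mul0r).
- by rewrite /onK /lower_at /split_at subrr !(mulr0, mul0r).
- by rewrite /onK (exprS (q ^+ 2)) raise_at_rec.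
- by rewrite /onK (exprS (q ^+ 2)) dual_eig_rec.
- by rewrite /onK /spec (exprS (q ^+ 2)) diag_at_rec.
- by rewrite /onK /spec /split_coef (exprS (q ^+ 2)) split_at_rec.
- by rewrite /onK /spec (exprS (q ^+ 2)) lower_at_rec.
- by rewrite /onK /spec /split_coef (exprS (q ^+ 2)) split_lower_at.
- by rewrite /onK /spec /split_coef (exprS (q ^+ 2)) lower_split_at.
by rewrite pactD !pactZ /onK theta_starE.
Qed.

Let X := [tuple ths N | N < n.+1].
Definition coef_on (L : 'I_n.+1) (w : V) : C := coord [tuple ths N | N < n.+1] L w.

Lemma coef_onD L u w : coef_on L (u + w) = coef_on L u + coef_on L w. Proof. exact: linearD. Qed.
Lemma coef_onB L u w : coef_on L (u - w) = coef_on L u - coef_on L w. Proof. exact: linearB. Qed.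
Lemma coef_onZ L a u : coef_on L (a *: u) = a * coef_on L u. Proof. exact: linearZ. Qed.
Lemma coef_on_sum L m (F : 'I_m -> V) : coef_on L (\sum_i F i) = \sum_i coef_on L (F i).
Proof. exact: linear_sum. Qed.

Lemma coef_on_ths L N : coef_on L (ths N) = (L == N)%:R.
Proof.
have -> : ths N = X`_N by rewrite -tnth_nth tnth_mktuple.
by rewrite /coef_on coord_free ?(basis_free (bi_basis AAs)) // eq_sym.
Qed.

Lemma coef_on_expand w : w = \sum_L coef_on L w *: ths L.
Proof.
rewrite {1}(coord_basis (bi_basis AAs) (memvf w)); apply: eq_bigr => L _.
by rewrite -tnth_nth tnth_mktuple.
Qed.

Lemma coef_on_As (L : 'I_n.+1) w : coef_on L (As w) = theta_star p L * coef_on L w.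
Proof.
rewrite {1}(coef_on_expand w) linear_sum /= coef_on_sum (bigD1 L) //= big1 => [|i /negbTE iL].
  by rewrite lfunZ coef_onZ (bi_As_ths AAs) coef_onZ coef_on_ths eqxx mulr1 addr0 mulrC.
by rewrite lfunZ coef_onZ (bi_As_ths AAs) coef_onZ coef_on_ths eq_sym iL !mulr0.
Qed.

Lemma coef_on_Y (L : 'I_n.+1) w : coef_on L (Y w) = \sum_(N < n.+1) coef_on N w * Y_entry n p L N.
Proof.
rewrite {1}(coef_on_expand w) linear_sum /= coef_on_sum; apply: eq_bigr => N _.
rewrite lfunZ coef_onZ (Yop_ths AAs) coef_on_sum (bigD1 L) //= big1 => [|i /negbTE iL].
  by rewrite coef_onZ coef_on_ths eqxx mulr1 addr0.
by rewrite coef_onZ coef_on_ths eq_sym iL mulr0.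
Qed.

(** Y raises the index by at most one, so Y^k v has no component beyond index k. *)
Lemma coef_on_iter_gt k (L : 'I_n.+1) : (k < L)%N -> coef_on L (iter k Y v) = 0.
Proof.
elim: k L => [|k IH] L kL /=; first by rewrite coef_on_ths -val_eqE /= gtn_eqF.
rewrite coef_on_Y big1 // => N _; have [Nk|kN] := leqP N k; last by rewrite IH ?mul0r.
by rewrite Y_entry_far ?mulr0 //; apply: leq_trans kL; rewrite ltnS.
Qed.

Definition Y_lead k : C := \prod_(j < k) Y_entry n p j.+1 j.

Lemma coef_on_iter_eq (L : 'I_n.+1) : coef_on L (iter L Y v) = Y_lead L.
Proof.
case: L => k kn /=; elim: k kn => [|k IH] kn; rewrite /Y_lead.
  by rewrite big_ord0 coef_on_ths.
have k'n : (k < n.+1)%N by apply: ltnW.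
rewrite big_ord_recr /= coef_on_Y (bigD1 (Ordinal k'n)) //= IH big1 ?addr0 //.
move=> N /negbTE Nk; have [Nk'|kN] := ltnP k N.
  by rewrite coef_on_iter_gt ?mul0r.
rewrite Y_entry_far ?mulr0 // ltnS ltn_neqAle kN andbT.
by apply/negbT; rewrite -Nk.
Qed.

Lemma coef_on_pact_gt (r : {poly C}) k (L : 'I_n.+1) :
  (size r <= k.+1)%N -> (k < L)%N -> coef_on L (pact Y v r) = 0.
Proof.
move=> sr kL; rewrite (pact_wide Y v sr) coef_on_sum big1 // => i _.
by rewrite coef_onZ coef_on_iter_gt ?mulr0 // (leq_ltn_trans _ kL) // -ltnS.
Qed.

Lemma coef_on_pact_eq (r : {poly C}) (L : 'I_n.+1) :
  (size r <= L.+1)%N -> coef_on L (pact Y v r) = r`_L * Y_lead L.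
Proof.
move=> sr; rewrite (pact_wide Y v sr) coef_on_sum big_ord_recr /= big1 => [|i _].
  by rewrite add0r coef_onZ coef_on_iter_eq.
by rewrite coef_onZ coef_on_iter_gt ?mulr0.
Qed.

Lemma ths_neq0 N : ths N != 0.
Proof.
apply/eqP => t0; have := coef_on_ths N N; rewrite t0 eqxx => /eqP.
by rewrite /coef_on linear0 eq_sym oner_eq0.
Qed.

(** Otherwise the span of |theta*_0>, ..., |theta*_k> would be stable under both A and A*, against
    irreducibility. *)
Lemma A_entry_sub_neq0 k : (k < n)%N -> A_entry n p k.+1 k != 0.
Proof.
move=> kn; apply/eqP => A0.
pose r := map ths (filter (fun i : 'I_n.+1 => (i <= k)%N) (enum 'I_n.+1)).
have rP (i : 'I_n.+1) : (i <= k)%N -> ths i \in <<r>>%VS.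
  by move=> ik; rewrite memv_span // map_f // mem_filter ik mem_enum.
have [||U0|Ufull] := bi_irreducible AAs (U := <<r>>%VS).
- rewrite limg_span; apply/span_subvP => _ /mapP[_ /mapP[i + ->] ->].
  rewrite mem_filter => /andP[ik _]; rewrite (bi_A_ths AAs).
  apply: memv_suml => L _; have [Lk|kL] := leqP L k; first by rewrite memvZ ?rP.
  have [iL|] := ltnP i.+1 L; first by rewrite A_entry_far // scale0r mem0v.
  move=> Li; have ik' : nat_of_ord i = k by apply/eqP; rewrite eqn_leq ik; lia.
  have Lk' : nat_of_ord L = k.+1 by lia.
  by rewrite Lk' ik' A0 scale0r mem0v.
- rewrite limg_span; apply/span_subvP => _ /mapP[_ /mapP[i + ->] ->].
  rewrite mem_filter => /andP[ik _].
  by rewrite (bi_As_ths AAs) memvZ ?rP.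
- have := rP ord0 (leq0n _); rewrite U0 memv0.
  by rewrite (negbTE (ths_neq0 ord0)).
have := dim_span r; rewrite Ufull (size_basis (bi_basis AAs)) size_map size_filter.
rewrite -[X in (X <= _)%N](size_enum_ord n.+1) => le.
have /allP/(_ ord_max) : all (fun i : 'I_n.+1 => (i <= k)%N) (enum 'I_n.+1).
  by rewrite all_count eqn_leq count_size.
by rewrite mem_enum /= leqNgt kn => /(_ isT).
Qed.

Lemma Y_lead_neq0 k : (k <= n)%N -> Y_lead k != 0.
Proof.
move=> kn; apply/prodf_neq0 => j _; have jn : (j < n)%N by apply: leq_trans kn.
by rewrite (Y_entry_sub AAs) !mulf_neq0 ?invr_eq0 ?A_entry_sub_neq0.
Qed.

(** The difference contains the factor c* - b* q^(2(i+j)), which genericity controls for i + j <=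
    2n. The index i = n + 1, outside the spectrum, is included. *)
Lemma theta_star_neq i j : (j < i)%N -> (i + j <= 2 * n)%N ->
  theta_star p i - theta_star p j != 0.
Proof.
move=> ji ij; rewrite !theta_starE /dual_eig.
rewrite (_ : _ - _ = - (((q ^+ 2) ^+ j) * ((q ^+ 2) ^+ (i - j) - 1)
    * (cs - bs * q ^+ (2 * (i + j)))) / ((q ^+ 2) ^+ i * (q ^+ 2) ^+ j)).
  rewrite !mulf_neq0 ?invr_eq0 ?oppr_eq0 ?mulf_neq0 ?(bcs_generic p_generic) //.
  by rewrite -exprM subr_eq0 (q_not_root_of_unity p_generic) // muln_gt0 subn_gt0.
rewrite exprM exprD -[in RHS](subnK (ltnW ji)) -[in LHS](subnK (ltnW ji)).
rewrite addnK !exprD; move: (K0 j) (K0 (i - j)).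
move: (_ ^+ j) (_ ^+ (i - j)) => x y x0 y0.
by field; rewrite x0 y0.
Qed.

(** As phi_(n+1) = 0, the vector w satisfies A* w = theta*_(n+1) w, which kills its coordinates of
    index below n. Genericity does not separate theta*_(n+1) from theta*_n, so coordinate n is
    computed directly. *)
Lemma newton_spec_eq0 : pact Y v (newton spec n.+1) = 0.
Proof.
set w := pact _ _ _.
have Asw : As w = theta_star p n.+1 *: w.
  by rewrite /w As_newton_spec /split_coef exprS exprAC split_at_last // scale0r addr0.
have cw (L : 'I_n.+1) : (theta_star p n.+1 - theta_star p L) * coef_on L w = 0.
  by rewrite mulrBl -coef_on_As -coef_onZ -Asw subrr.
rewrite (coef_on_expand w) big1 // => L _.
have [Ln|nL] := ltnP L n.
  have tL : theta_star p n.+1 - theta_star p L != 0.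
    by apply: theta_star_neq => //; lia.
  by have /eqP := cw L; rewrite mulf_eq0 (negbTE tL) => /eqP ->; rewrite scale0r.
have -> : L = ord_max by apply/val_inj/eqP; rewrite eqn_leq nL -ltnS ltn_ord.
rewrite (_ : coef_on _ _ = 0) ?scale0r //.
have n'n : (n.-1 < n.+1)%N by rewrite ltnS leq_pred.
pose N1 : 'I_n.+1 := Ordinal n'n.
(* Since w = (Y - chi_n) e and Y is tridiagonal, only coordinates n and n - 1 of e matter; the
   latter follows from the action of A* on e. *)
pose e := pact Y v (newton spec n).
have wE : w = Y e - spec n *: e by rewrite /w newtonS pactMXC.
have cN1 : coef_on N1 (pact Y v (newton spec n.-1)) = Y_lead n.-1.
  by rewrite coef_on_pact_eq ?size_prodX_ord //= lead_prodX_ord mul1r.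
have cN : coef_on ord_max e = Y_entry n p n n.-1 * Y_lead n.-1.
  rewrite coef_on_pact_eq ?size_prodX_ord //= lead_prodX_ord mul1r.
  by rewrite -{1}(prednK n_gt0) /Y_lead big_ord_recr mulrC /= prednK.
have cN1e : (theta_star p n - theta_star p n.-1) * coef_on N1 e = - split_coef n * Y_lead n.-1.
  have := coef_on_As N1 e; rewrite /e As_newton_spec -/e coef_onD !coef_onZ cN1 /= => h.
  by rewrite mulrBl -h; ring.
have tn : theta_star p n - theta_star p n.-1 != 0.
  by apply: theta_star_neq; rewrite ?prednK //; lia.
have {}cN1e : coef_on N1 e = - split_coef n * Y_lead n.-1 / (theta_star p n - theta_star p n.-1).
  by rewrite -cN1e mulrAC mulfV ?mul1r.
rewrite wE coef_onB coef_onZ coef_on_Y (bigD1 ord_max) //= (bigD1 N1) /=; last first.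
  by rewrite -val_eqE /= neq_ltn prednK ?leqnn.
rewrite big1 ?addr0 => [|i /andP[i1 i2]]; last first.
  rewrite Y_entry_far ?mulr0 //; have := ltn_ord i.
  move: i1 i2; rewrite -!val_eqE /=; lia.
rewrite cN cN1e (Y_entry_last AAs n_gt0) /spec /split_coef exprAC !theta_starE.
rewrite [(q ^+ 2) ^+ n]exprAC in tn *.
have -> : (q ^+ 2) ^+ n.-1 = T ^+ 2 / q ^+ 2.
  apply: (mulIf (expf_neq0 2 q0)); rewrite divfK ?expf_neq0 //.
  by rewrite -exprSr prednK // exprAC.
by ring.
Qed.

End Spectrum.

(** * The Bethe equations in the variable x = q u^2 + 1/(q u^2) *)

Section BetheScalars.
Variables (C : fieldType) (n : nat) (p : aw_param C).
Hypothesis p_generic : generic_param n p.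
Local Notation q := (par_q p).
Local Notation b := (par_b p).
Local Notation bs := (par_bs p).
Local Notation cs := (par_cs p).
Local Notation zeta := (par_zeta p).
Local Notation T := (q ^+ n).
Let q0 : q != 0 := q_neq0 p_generic.
Let b0 : b != 0 := b_neq0 p_generic.
Let cs0 : cs != 0 := cs_neq0 p_generic.
Let zeta0 : zeta != 0 := zeta_neq0 p_generic.
Let q4 : q ^+ 4 != 1 := q4_neq1 p_generic.
Let T0 : T != 0 := expf_neq0 n q0.

Definition xval (u : C) : C := q * u ^+ 2 + (q * u ^+ 2)^-1.

Lemma xvalE u : xval u = q * u ^+ 2 + q^-1 * u ^- 2.
Proof. by rewrite /xval invfM. Qed.

Lemma bfunM (x y : C) : x != 0 -> y != 0 ->
  bfun x * bfun y = x * y + (x * y)^-1 - (x / y + (x / y)^-1).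
Proof. by move=> x0 y0; rewrite /bfun; field; rewrite x0 y0. Qed.

Lemma bfun_xval (u v : C) : u != 0 -> v != 0 ->
  bfun (u / v) * bfun (q * u * v) = xval u - xval v.
Proof. by move=> u0 v0; rewrite /bfun /xval; field; rewrite u0 v0 q0. Qed.

(** Both numerator and denominator of f are differences of x-values up to sign, the numerator with z
    = q u^2 shifted to q^-2 z; for h the shift is q^2 z. *)
Lemma bethe_fE (u v : C) : u != 0 -> v != 0 ->
  bethe_f p u v = (q ^- 2 * (q * u ^+ 2) + (q ^- 2 * (q * u ^+ 2))^-1 - xval v)
                  / (xval u - xval v).
Proof.
move=> u0 v0; rewrite /bethe_f.
rewrite -[xval u - _]opprB -(bfun_xval v0 u0) invrN mulrN -mulNr.
by congr (_ / _); rewrite /bfun /xval; field; rewrite u0 v0 q0.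
Qed.

Lemma bethe_hE (u v : C) : u != 0 -> v != 0 ->
  bethe_h p u v = (q ^+ 2 * (q * u ^+ 2) + (q ^+ 2 * (q * u ^+ 2))^-1 - xval v)
                  / (xval u - xval v).
Proof.
move=> u0 v0; rewrite /bethe_h [in X in _ / X]mulrC bfun_xval //.
by congr (_ / _); rewrite /bfun /xval; field; rewrite u0 v0 q0.
Qed.

Lemma bfun_neq0 (z : C) : z != 0 -> (bfun z != 0) = (z * z - 1 != 0).
Proof.
move=> z0; have -> : bfun z = (z * z - 1) / z by rewrite /bfun; field.
by rewrite mulf_eq0 invr_eq0 (negbTE z0) orbF.
Qed.

Lemma qdiff_weight_Lambda2 u : u != 0 -> bfun (u ^+ 2) != 0 -> bfun (q * u ^+ 2) != 0 ->
  qdiff_weight q b bs cs zeta T (q * u ^+ 2) =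
  bfun q * Lambda2 n p true u / (q ^+ 2 * u * bfun (u ^+ 2)).
Proof.
move=> u0 u4 z0; have uu0 := expf_neq0 2 u0.
have qu0 := mulf_neq0 q0 uu0.
move: u4 z0; rewrite !bfun_neq0 // => u4 z0; rewrite /qdiff_weight /Lambda2 /= !(expfzDr _ _ q0) -!invr_expz /bfun.
rewrite -[q ^ n]/(q ^+ n) -[q ^ 1]/q expr0 expr1; field.
by rewrite u0 q0 b0 T0 zeta0 -?expr2 u4 z0.
Qed.

Lemma qdiff_weight_Lambda1 u : u != 0 -> bfun (q * u ^+ 2) != 0 ->
  qdiff_weight q b bs cs zeta T (q * u ^+ 2)^-1 =
  - (bfun q * u ^+ 3 * Lambda1 n p true u / bfun (q * u ^+ 2)).
Proof.
move=> u0 z0; have uu0 := expf_neq0 2 u0.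
have qu0 := mulf_neq0 q0 uu0.
move: z0; rewrite !bfun_neq0 // => z0; rewrite /qdiff_weight /Lambda1 /= !(expfzDr _ _ q0) -!invr_expz /bfun.
rewrite -[q ^ n]/(q ^+ n) -[q ^ 1]/q expr0 expr1; field.
by rewrite u0 q0 b0 T0 zeta0 z0 oner_neq0 mulNr -opprB oppr_eq0 z0.
Qed.

(** Two geometric series. Up to sign this is the subleading coefficient of chi. *)
Lemma sum_spec : \sum_(k < n.+1) spec n p k =
  (zeta ^+ 2 + zeta ^- 2) * (q * T - (q * T)^-1) / (q - q^-1).
Proof.
have qq1 : q * q - 1 != 0.
  by rewrite -expr2 subr_eq0 (q_not_root_of_unity p_generic).
suff H m : \sum_(k < m) spec n p k = zeta ^+ 2 / T * ((q ^+ 2) ^+ m - 1) / (q ^+ 2 - 1)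
    + T / zeta ^+ 2 * (1 - ((q ^+ 2) ^+ m)^-1) / (1 - q ^- 2).
  rewrite H (exprS (q ^+ 2)) [(q ^+ 2) ^+ n]exprAC; field.
  by rewrite q0 T0 zeta0 qq1.
elim: m => [|m IH]; first by rewrite big_ord0 expr0 invr1 !subrr !(mulr0, mul0r) addr0.
rewrite big_ord_recr /= IH /spec /spec_at (exprS (q ^+ 2)).
have := expf_neq0 m (expf_neq0 2 q0); move: (_ ^+ m) => K K0.
by field; rewrite q0 K0 T0 zeta0 qq1.
Qed.

(** Index k of the first factor is paired with n - k of the second. The powers x, y of the square
    root of q then satisfy x y = q and x / y = q^(2k-n), and the pair multiplies to [xval u] -
    chi_k. *)
Lemma prod_bfun_spec u : u != 0 ->
  \prod_(k < n.+1) (bfun (q_half p ^ (1 + 2 * k%:Z - n%:Z) * zeta * u) *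
                    bfun (q_half p ^ (1 + 2 * k%:Z - n%:Z) * zeta^-1 * u))
  = (newton (spec n p) n.+1).[xval u].
Proof.
move=> u0; rewrite big_split /= [X in _ * X](reindex_inj rev_ord_inj) -big_split /=.
rewrite horner_prod; apply: eq_bigr => k _; rewrite hornerXsubC.
have h0 : q_half p != 0.
  by apply: contraNneq q0 => h0; rewrite -(q_halfE p_generic) h0 expr0n.
have kn : (k <= n)%N by rewrite -ltnS.
rewrite bfunM ?mulf_neq0 ?expfz_neq0 ?invr_eq0 //.
rewrite subSS; set x := q_half p ^ _; set y := q_half p ^ _.
have x0 : x != 0 by apply: expfz_neq0.
have y0 : y != 0 by apply: expfz_neq0.
have xy : x * y = q.
  rewrite -expfzDr // -[RHS](q_halfE p_generic).
    by rewrite -[RHS]/(q_half p ^ 2); congr (_ ^ _); lia.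
have xqy : x * T = y * (q ^+ 2) ^+ k.
  rewrite -[q ^+ n]/(q ^ n%:Z) -[(_ ^+ 2) ^+ k]exprM -[q ^+ _]/(q ^ (2 * k)%N%:Z).
  rewrite -(q_halfE p_generic) -[q_half p ^+ 2]/(q_half p ^ 2) !exprz_exp -!expfzDr //.
  by congr (_ ^ _); lia.
have e : (q ^+ 2) ^+ k = x * T / y by rewrite xqy mulrAC mulfV ?mul1r.
rewrite /spec /spec_at e /xval; move: (T) T0 => t t0; rewrite -xy.
by field; rewrite x0 y0 t0 zeta0 u0.
Qed.

End BetheScalars.

(** * Eigenvectors of A from solutions of the Bethe equations *)

Section BetheEigenvector.
Variables (C : fieldType) (V : vectType C) (n : nat) (p : aw_param C).
Variables (A As : 'End(V)) (ths : 'I_n.+1 -> V).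
Hypothesis AAs : bispectral p A As ths.
Hypothesis n_gt0 : (0 < n)%N.
Local Notation q := (par_q p).
Local Notation b := (par_b p).
Local Notation bs := (par_bs p).
Local Notation cs := (par_cs p).
Local Notation zeta := (par_zeta p).
Local Notation T := (q ^+ n).
Local Notation Y := (Yop n p A As).
Local Notation v := (ths ord0).
Local Notation xval := (xval p).
Let p_generic := bi_generic AAs.
Let q0 : q != 0 := q_neq0 p_generic.
Let b0 : b != 0 := b_neq0 p_generic.
Let bs0 : bs != 0 := bs_neq0 p_generic.
Let cs0 : cs != 0 := cs_neq0 p_generic.
Let zeta0 : zeta != 0 := zeta_neq0 p_generic.
Let q4 : q ^+ 4 != 1 := q4_neq1 p_generic.
Let T0 : T != 0 := expf_neq0 n q0.

Variable u : 'I_n -> C.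
Hypothesis u_solution : bethe_solution p true u.

Definition bethe_poly : {poly C} := \prod_(i < n) ('X - (xval (u i))%:P).

Let u0 i : u i != 0. Proof. by have [] := bethe_nontrivial u_solution i. Qed.

Let buu0 i : bfun (u i ^+ 2) != 0.
Proof.
have [_] := bethe_nontrivial u_solution i.
by rewrite /bfun subr_eq0.
Qed.

Let bq0 : bfun q != 0.
Proof.
rewrite (bfun_neq0 q0) -expr2 subr_eq0.
exact: (q_not_root_of_unity p_generic).
Qed.

Lemma xval_inj i j : i != j -> xval (u i) - xval (u j) != 0.
Proof.
move/(bethe_admissible u_solution); apply: contraNneq => /subr0_eq.
by rewrite /bethe_U !xvalE => ->.
Qed.

(** The i-th Bethe equation after clearing g(x_i): Lambda_2 and Lambda_1 become the weights at z and
    1/z, the products of h and f become shifted values of g, and the inhomogeneous term becomes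
    chi(x_i). *)
Lemma bethe_qdiff (i : 'I_n) (g := \prod_(j < n | j != i) ('X - (xval (u j))%:P))
    (z := q * u i ^+ 2) :
  qdiff_weight q b bs cs zeta T z * g.[q ^+ 2 * z + (q ^+ 2 * z)^-1]
  + qdiff_weight q b bs cs zeta T z^-1 * g.[q ^- 2 * z + (q ^- 2 * z)^-1]
  = cs / q * (q ^- 2) ^+ n * (newton (spec n p) n.+1).[xval (u i)].
Proof.
have := bethe_equations u_solution i; rewrite /bethe_E.
rewrite prod_bfun_spec //.
rewrite (eq_bigr _ (fun j _ => bethe_fE p_generic (u0 i) (u0 j))).
rewrite [in X in _ - X](eq_bigr _ (fun j _ => bethe_hE p_generic (u0 i) (u0 j))).
rewrite [\prod_(j < n | _) (bfun _ * _)](eq_bigr (fun j => xval (u i) - xval (u j))); last first.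
  by move=> j _; rewrite (bfun_xval p_generic).
rewrite !prodf_div (qdiff_weight_Lambda2 p_generic) ?(bethe_defined u_solution) //.
rewrite (qdiff_weight_Lambda1 p_generic) ?(bethe_defined u_solution) //.
have gE y : g.[y] = \prod_(j < n | j != i) (y - xval (u j)).
  by rewrite /g horner_prod; apply: eq_bigr => j _; rewrite hornerXsubC.
rewrite -!gE -/z.
have g0 : g.[xval (u i)] != 0.
  by rewrite gE; apply/prodf_neq0 => j ji; rewrite xval_inj // eq_sym.
rewrite /nu /= !(expfzDr _ _ q0) -!invr_expz expz2 exprVn.
rewrite -[q ^ 1]/q -[u i ^ 1]/(u i) -[u i ^ 2]/(u i ^+ 2).
rewrite -[(_ * _) ^ 1]/(q ^+ 2 * u i ^+ 3) -/z.
have bz0 : bfun z != 0 := bethe_defined u_solution i.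
move: g0 (buu0 i) bq0 bz0 (u0 i) (expf_neq0 n (expf_neq0 2 q0)).
move: (bfun (u i ^+ 2)) (bfun q) (bfun z) (Lambda1 _ _ _ _) (Lambda2 _ _ _ _) => bu bq bz L1 L2.
move: (g.[xval (u i)]) (g.[q ^- 2 * z + _]) (g.[q ^+ 2 * z + _]).
move=> gi gm gp; set ch := horner (newton _ _) _.
move: ch ((q ^+ 2) ^+ n) (u i) => ch Kn ui gi0 bu0 bq' bz0 ui0 Kn0 E.
(* The factor clears g(x_i) and turns the coefficient of Lambda_2 into the weight at z. *)
apply/eqP; rewrite -subr_eq0 -(mulr0 (- (bq * ui ^+ 2 * gi / bu))) -E; apply/eqP.
by field; rewrite gi0 bu0 bq' bz0 ui0 Kn0 q0.
Qed.

(** In [R] the constant a cancels degree n + 1 and the energy cancels degree n. By admissibility [R]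
    still has n distinct roots x_i, so it is zero. *)
Lemma bethe_eigen : A (pact Y v bethe_poly) = energy_plus p u *: pact Y v bethe_poly.
Proof.
have AY := A_Yop AAs; have AsY := As_Yop AAs.
rewrite (etaE p_generic) in AY; rewrite (eta_starE p_generic) in AsY.
have th0 : As v = (bs + cs) *: v.
  by rewrite (bi_As_ths AAs) theta_starE /dual_eig /= expr0 invr1 !mulr1.
have [D [Ds im]] := aw_image_ex q0 AY AsY th0 (A_ths0 AAs n_gt0)
   (qdiff_weight_sum bs cs q0 b0 zeta0 T0 q4) (qdiff_weight_dual_sum bs cs q0 b0 zeta0 T0 q4) bethe_poly.
have sP : size bethe_poly = n.+1 by exact: size_prodX_ord.
pose a := cs / q * (q ^- 2) ^+ n.
pose R := D - a *: newton (spec n p) n.+1 - energy_plus p u *: bethe_poly.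
suff R0 : R = 0.
  rewrite (A_pact im); apply/eqP; rewrite -subr_eq0 -pactZ -pactB.
  have -> : D - energy_plus p u *: bethe_poly = R + a *: newton (spec n p) n.+1.
    by rewrite /R addrAC subrK.
  by rewrite R0 add0r pactZ (newton_spec_eq0 AAs) ?scaler0.
have sR : (size R <= n)%N.
  apply/leq_sizeP => j nj.
  rewrite /R !coefB !coefZ.
  have sj x : (x < j)%N -> forall r : {poly C}, (size r <= x.+1)%N -> r`_j = 0.
    by move=> xj r sr; apply: (leq_sizeP _ _ sr).
  have [jn|nj'] := eqVneq j n.
    (* Degree n: the sums of the x_i and of the chi_k assemble into the energy. *)
    rewrite jn (sublead_A im) ?sP // lead_prodX_ord (sublead_prodX_ord (m := n.+1)) //.
    rewrite coefMX -[n == 0%N]negbK -lt0n n_gt0 /= sublead_prodX_ord // sum_spec //.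
    rewrite /a /energy_plus /qint -!invr_expz expz2 exprVn /A_shift.
    rewrite -[q ^ n]/(q ^+ n) -(eq_bigr _ (fun i _ => xvalE p (u i))).
    rewrite [(q ^+ 2) ^+ n]exprAC (par_cE p_generic).
    move: (\sum_(_ < _) _) => S; field.
    by rewrite q0 b0 T0 zeta0 -expr2 subr_eq0 (q_not_root_of_unity p_generic).
  have [jn|nj''] := eqVneq j n.+1.
    rewrite jn (lead_A im) ?sP // !lead_prodX_ord.
    by rewrite (leq_sizeP _ _ (_ : size bethe_poly <= n.+1)%N) ?sP // /a; ring.
  have n2j : (n.+1 < j)%N by lia.
  rewrite (sj _ n2j) ?(size_A im) ?sP // (sj _ n2j) ?size_prodX_ord //.
  by rewrite (leq_sizeP _ _ (_ : size bethe_poly <= n.+1)%N) ?sP // ?mulr0 ?subr0 //; lia.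
apply: contraTeq sR => R0; rewrite -ltnNge.
have := max_poly_roots R0 (rs := [seq xval (u i) | i <- enum 'I_n]).
rewrite size_map size_enum_ord; apply.
  apply/allP => _ /mapP[i _ ->]; rewrite /root /R !(hornerE, hornerN) /=.
  pose g := \prod_(j < n | j != i) ('X - (xval (u j))%:P).
  have Pg : bethe_poly = ('X - (xval (u i))%:P) * g by rewrite /bethe_poly (bigD1 i).
  have P0 : bethe_poly.[xval (u i)] = 0 by rewrite Pg hornerM hornerXsubC subrr mul0r.
  have z0 : q * u i ^+ 2 != 0 by rewrite mulf_neq0 ?expf_neq0.
  have z1 : q * u i ^+ 2 * (q * u i ^+ 2) - 1 != 0.
    by rewrite -bfun_neq0 //; apply: bethe_defined u_solution i.
  (* At the root x_i the divided differences of the Bethe polynomial are values of g. *)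
  rewrite {1}/xval (horner_A im z0 z1) -/(xval (u i)) P0 mulr0 add0r /qdiff.
  by rewrite Pg -/(xval (u i)) !ddiff_factor bethe_qdiff mulr0 !subrr.
rewrite map_inj_uniq ?enum_uniq // => i j ij.
by apply: contraTeq (eqxx (0 : C)) => /xval_inj; rewrite ij subrr.
Qed.

End BetheEigenvector.

(** * Bethe states and their normalization *)

Section BetheState.
Variables (C : fieldType) (V : vectType C) (n : nat) (p : aw_param C).
Variables (A As : 'End(V)) (ths : 'I_n.+1 -> V).
Hypothesis AAs : bispectral p A As ths.
Hypothesis n_gt0 : (0 < n)%N.
Local Notation q := (par_q p).
Local Notation cs := (par_cs p).
Local Notation Y := (Yop n p A As).
Local Notation v := (ths ord0).
Let p_generic := bi_generic AAs.
Let q0 : q != 0 := q_neq0 p_generic.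
Let cs0 : cs != 0 := cs_neq0 p_generic.
Let kap := q ^+ 2 - q ^- 2.
Let kap0 : kap != 0 := kap_neq0 p_generic.

Variables (chi alpha : C) (m0 : int).
Hypothesis chi0 : chi != 0.
Hypothesis alphaE : (q ^ 2 - q ^ (-2)) * chi^-1 * alpha * cs * q ^ m0 = 1.

Variable u : 'I_n -> C.
Hypothesis u_solution : bethe_solution p true u.

Let u0 i : u i != 0. Proof. by have [] := bethe_nontrivial u_solution i. Qed.

Lemma Bop_pact (w : C) (r : {poly C}) : w != 0 ->
  Bop n p A As chi w (pact Y v r) =
  - (chi * bfun (w ^+ 2) / kap) *: pact Y v (('X - (xval p w)%:P) * r).
Proof.
move=> w0; rewrite [_ * r]mulrC pactMXC YopE /Bop scale_lfunE !add_lfunE scale_lfunE add_lfunE !scale_lfunE id_lfunE qcommE.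
rewrite xvalE -[q ^ 2 - _]/kap.
apply: vec_eqP => f fD fZ fN; rewrite !(fD, fN, fZ) -/kap.
field; rewrite w0 q0 kap0 (rho_neq0 p_generic) -expr2 subr_eq0.
by rewrite (q_not_root_of_unity p_generic).
Qed.

(** The condition on alpha turns alpha^-1 q^(-m0) chi / kap into c*, and the shift of m0 at position
    i leaves q^(2i-2n). *)
Definition B_coef (i : 'I_n) : C :=
  - cs * (q ^+ 2) ^+ i / (q ^+ 2) ^+ n * (u i)^-1 * bfun (u i ^+ 2).

Lemma B_plus_pact (i : 'I_n) (r : {poly C}) :
  B_plus n p A As chi alpha (u i) (m0 + 2 * (n%:Z - i.+1%:Z)) (pact Y v r) =
  B_coef i *: pact Y v (('X - (xval p (u i))%:P) * r).
Proof.
rewrite /B_plus scale_lfunE Bop_pact // scalerA; congr (_ *: _).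
rewrite /B_coef mulrBr opprD opprB !(expfzDr _ _ q0) -!invr_expz !expz2.
have al0 : alpha != 0 by apply: contraTneq (oner_neq0 C) => al0; rewrite -alphaE al0 mulr0 !mul0r eqxx.
have qm0 : q ^ m0 != 0 by apply: expfz_neq0.
have qmE : q ^ m0 = chi / (kap * alpha * cs).
  apply: (mulfI (mulf_neq0 (mulf_neq0 (mulf_neq0 kap0 (invr_neq0 chi0)) al0) cs0)).
  rewrite -[in LHS]/((q ^ 2 - q ^ (-2)) * chi^-1 * alpha * cs * q ^ m0) alphaE.
  by field; rewrite kap0 al0 cs0 chi0.
rewrite qmE (exprS (q ^+ 2)) -[q ^ 2]/(q ^+ 2).
have := expf_neq0 n (expf_neq0 2 q0); move: ((q ^+ 2) ^+ n) ((q ^+ 2) ^+ i) => Kn K Kn0.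
by field; rewrite kap0 al0 cs0 chi0 Kn0 u0 q0.
Qed.

Lemma Psi_plus_pact : Psi_plus p A As chi alpha m0 u v =
  (\prod_(i < n) B_coef i) *: pact Y v (bethe_poly p u).
Proof.
have vE : v = pact Y v 1 by rewrite -polyC1 pactC scale1r.
rewrite /Psi_plus /bethe_poly {1}vE.
elim: (index_enum _) => [|i r IH]; first by rewrite !big_nil id_lfunE scale1r.
by rewrite !big_cons comp_lfunE IH lfunZ B_plus_pact scalerA mulrC.
Qed.

(** For each k, [B_coef] times the subdiagonal entry of Y is the normalizing factor times q to the
    power 2(2k + 1 - n); these exponents sum to zero. *)
Lemma norm_plusK : norm_plus p u * ((\prod_(i < n) B_coef i) * Y_lead n p n) = 1.
Proof.
have norm_neq0 (k : 'I_n) : - q^-1 * (u k)^-1 * bfun (u k ^+ 2) * A_entry n p k.+1 k != 0.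
  rewrite !mulf_neq0 ?oppr_eq0 ?invr_eq0 ?(A_entry_sub_neq0 AAs) //.
  have [_] := bethe_nontrivial u_solution k.
  by rewrite /bfun subr_eq0.
rewrite /norm_plus prodfV.
suff -> : (\prod_(i < n) B_coef i) * Y_lead n p n =
   \prod_(k < n) (- q^-1 * (u k)^-1 * bfun (u k ^+ 2) * A_entry n p k.+1 k).
  by rewrite mulVf //; apply/prodf_neq0 => k _.
rewrite /Y_lead -big_split /=.
rewrite (eq_bigr (fun k : 'I_n => (- q^-1 * (u k)^-1 * bfun (u k ^+ 2) * A_entry n p k.+1 k)
   * ((q ^+ 2) ^+ k.+1 / (q ^+ 2) ^+ n * (q ^+ 2) ^+ k))); last first.
  move=> k _; rewrite /B_coef (Y_entry_sub AAs) (exprS (q ^+ 2)).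
  have := expf_neq0 n (expf_neq0 2 q0); move: ((q ^+ 2) ^+ n) ((q ^+ 2) ^+ k) => Kn K Kn0.
  by field; rewrite Kn0 cs0 u0 q0.
rewrite big_split /= [X in _ * X]big_split /= [X in _ * (_ * X)](reindex_inj rev_ord_inj).
rewrite -[X in _ * X]big_split /=.
rewrite [X in _ * X]big1 ?mulr1 // => k _.
rewrite mulrAC -exprD addnC subnK ?mulfV //.
by rewrite expf_neq0 // expf_neq0.
Qed.

Variable th : 'I_n.+1 -> V.
Hypothesis th_basis : basis_of fullv [tuple th M | M < n.+1].
Hypothesis A_th : forall M : 'I_n.+1, A (th M) = theta p M *: th M.
Hypothesis theta_inj : injective (fun M : 'I_n.+1 => theta p M).

(** The spectrum is simple, so the Bethe vector is e times |theta_M>. Its coordinate on |theta*_n>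
    is [Y_lead], and [norm_plusK] then fixes the scalar without dividing by e. *)
Lemma th_bethe (M : 'I_n.+1) : theta p M = energy_plus p u ->
  th M = (norm_plus p u * coef_on ths ord_max (th M)) *:
         Psi_plus p A As chi alpha m0 u v.
Proof.
move=> thE; set w := pact Y v (bethe_poly p u).
have Aw : A w = theta p M *: w by rewrite thE; apply: bethe_eigen.
have [e we] : exists e, w = e *: th M.
  pose d L := coord [tuple th M | M < n.+1] L w.
  have thE' N : th N = [tuple th M | M < n.+1]`_N by rewrite -tnth_nth tnth_mktuple.
  have wd : w = \sum_L d L *: th L.
    rewrite {1}(coord_basis th_basis (memvf w)); apply: eq_bigr => L _.
    by rewrite -thE'.
  have dA L : theta p M * d L = theta p L * d L.
    have := congr1 (coord [tuple th M | M < n.+1] L) Aw.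
    rewrite linearZ /= -/(d L) => <-; rewrite {1}wd linear_sum linear_sum /=.
    rewrite (bigD1 L) //= big1 ?addr0 => [|N /negbTE NL].
      by rewrite lfunZ A_th !linearZ /= thE' coord_free ?(basis_free th_basis) // eqxx mulr1 mulrC.
    by rewrite lfunZ A_th !linearZ /= thE' coord_free ?(basis_free th_basis) // NL !mulr0.
  exists (d M); rewrite {1}wd (bigD1 M) //= big1 ?addr0 // => L LM.
  have /eqP := dA L; rewrite -subr_eq0 -mulrBl mulf_eq0 subr_eq0 => /orP[/eqP ML|/eqP ->].
    by rewrite (theta_inj ML) eqxx in LM.
  by rewrite scale0r.
have cw : coef_on ths ord_max w = Y_lead n p n.
  by rewrite (coef_on_pact_eq AAs) ?size_prodX_ord //= lead_prodX_ord mul1r.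
rewrite Psi_plus_pact -/w scalerA we scalerA.
rewrite -[LHS]scale1r -[in LHS]norm_plusK -cw we coef_onZ; congr (_ *: _).
ring.
Qed.

End BetheState.

(** * Duality: A and A* exchanged, with q, zeta and the Bethe roots inverted *)

Definition inv_dual (C : fieldType) (p : aw_param C) : aw_param C :=
  AWParam (par_q p)^-1 (q_half p)^-1 (par_cs p) (par_bs p) (par_c p) (par_b p) (par_zeta p)^-1.

Section Duality.
Variables (C : fieldType) (n : nat) (p : aw_param C).
Hypothesis p_generic : generic_param n p.
Local Notation q := (par_q p).
Local Notation b := (par_b p).
Local Notation c := (par_c p).
Local Notation bs := (par_bs p).
Local Notation cs := (par_cs p).
Local Notation zeta := (par_zeta p).
Local Notation T := (q ^+ n).
Let q0 : q != 0 := q_neq0 p_generic.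
Let b0 : b != 0 := b_neq0 p_generic.
Let c0 : c != 0 := c_neq0 p_generic.
Let bs0 : bs != 0 := bs_neq0 p_generic.
Let cs0 : cs != 0 := cs_neq0 p_generic.
Let zeta0 : zeta != 0 := zeta_neq0 p_generic.
Let T0 : T != 0 := expf_neq0 n q0.
Local Notation p' := (inv_dual p).
Let q2 : q * q - 1 != 0.
Proof. by rewrite -expr2 subr_eq0 (q_not_root_of_unity p_generic). Qed.

Let q2' : q * q + 1 != 0.
Proof. exact: sqrD1_neq0 (q4_neq1 p_generic). Qed.

Lemma inv_dual_generic : generic_param n p'.
Proof.
split; rewrite //= ?invr_eq0 //.
- move=> k k0; rewrite exprVn invr_eq1; exact: (q_not_root_of_unity p_generic).
- by rewrite exprVn (q_halfE p_generic).
- by rewrite mulrC -(bc_eq p_generic) mulrC.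
- move=> k kn; have Q0 := expf_neq0 (2 * k) q0.
  apply: contra_neq (bcs_generic p_generic kn) => h.
  apply: (mulIf (invr_neq0 Q0)); rewrite mul0r mulrBl mulfK // -exprVn -opprB.
  by rewrite h oppr0.
- move=> k kn; have Q0 := expf_neq0 (2 * k) q0.
  apply: contra_neq (bc_generic p_generic kn) => h.
  apply: (mulIf (invr_neq0 Q0)); rewrite mul0r mulrBl mulfK // -exprVn -opprB.
  by rewrite h oppr0.
Qed.

(** Inverting q swaps q^(2M) with q^(-2M); [inv_dual] compensates by exchanging the two coefficients
    as well as the stars. *)
Lemma theta_inv_dual M : theta p' M = theta_star p M.
Proof. by rewrite /theta_star !thetaE /= !exprVn invrK addrC. Qed.

Lemma theta_star_inv_dual M : theta_star p' M = theta p M.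
Proof. by rewrite /theta_star !thetaE /= !exprVn invrK addrC. Qed.

Lemma Astar_up_inv_dual  M :
  Astar_up n (dual_param p') M = Astar_up n p M.
Proof.
rewrite (Astar_upE (dual_generic inv_dual_generic)) (Astar_upE p_generic) /=.
rewrite !exprVn !invrK.
have := expf_neq0 M (expf_neq0 2 q0); move: ((q ^+ 2) ^+ M) (T) T0 => K t t0 K0.
(* The denominators change by monomials only. Generalizing their inverses leaves no nonvanishing
   condition on them. *)
have -> : b - c * (K ^- 2 * q ^+ 2) = - (q ^+ 2 / K ^+ 2) * (c - b * (K ^+ 2 / q ^+ 2)).
  by field; rewrite K0 ?q0 ?oner_neq0.
have -> : b - c * K ^- 2 = - (K ^- 2) * (c - b * K ^+ 2).
  by field; rewrite K0 ?oner_neq0.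
move: (c - b * (_ / _)) (c - b * K ^+ 2) => D1 D2.
rewrite !invfM; move: (D1^-1) (D2^-1) => {}D1 {}D2.
by field; rewrite q0 zeta0 t0 K0 !oppr_eq0 oner_neq0 expf_neq0.
Qed.

Lemma Astar_down_inv_dual M : Astar_down n (dual_param p') M = Astar_down n p M.
Proof.
rewrite (Astar_downE (dual_generic inv_dual_generic)) (Astar_downE p_generic) /=.
rewrite !exprVn !invrK.
have := expf_neq0 M (expf_neq0 2 q0); move: ((q ^+ 2) ^+ M) (T) T0 => K t t0 K0.
have -> : b - c * (K ^- 2 * q ^+ 4) = - (q ^+ 4 / K ^+ 2) * (c - b * (K ^+ 2 / q ^+ 4)).
  by field; rewrite K0 ?q0 ?oner_neq0.
have -> : b - c * (K ^- 2 * q ^+ 2) = - (q ^+ 2 / K ^+ 2) * (c - b * (K ^+ 2 / q ^+ 2)).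
  by field; rewrite K0 ?q0 ?oner_neq0.
move: (c - b * (_ / q ^+ 4)) (c - b * (_ / q ^+ 2)) => D1 D2.
rewrite !invfM; move: (D1^-1) (D2^-1) => {}D1 {}D2.
by field; rewrite q0 zeta0 t0 K0 !oppr_eq0 !expf_neq0.
Qed.

Lemma A_entry_inv_dual L N : A_entry n p' L N = Astar_entry n p L N.
Proof.
rewrite /A_entry /Astar_entry !Astar_up_inv_dual !Astar_down_inv_dual.
by rewrite -(theta_inv_dual 0) /theta_star !thetaE.
Qed.

Lemma rho_inv_dual : rho p' = rho p.
Proof.
rewrite !rhoE /= [cs * bs]mulrC (bc_eq p_generic) !exprVn invrK.
by rewrite -[q ^- 2 - _]opprB sqrrN.
Qed.

Lemma omega_inv_dual : omega n p' = omega n p.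
Proof.
rewrite /omega /= !(expfzDr _ _ q0) !(expfzDr _ _ (invr_neq0 q0)) -!invr_expz.
rewrite -![_ ^ n%:Z]/(_ ^+ n) -![_ ^ 1]/(_) [cs * bs]mulrC (bc_eq p_generic) exprVn.
move: (T) T0 => t t0; field.
by rewrite t0 q0 zeta0 oner_neq0.
Qed.

Lemma eta_inv_dual : eta n p' = eta_star n p.
Proof.
rewrite /eta_star /eta /= !(expfzDr _ _ q0) !(expfzDr _ _ (invr_neq0 q0)) -!invr_expz.
rewrite -![_ ^ n%:Z]/(_ ^+ n) -![_ ^ 1]/(_) [cs * bs]mulrC exprVn.
move: (T) T0 => t t0; field.
by rewrite t0 q0 zeta0 q2' oner_neq0.
Qed.

Lemma eta_star_inv_dual : eta_star n p' = eta n p.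
Proof.
rewrite /eta_star /eta /= !(expfzDr _ _ q0) !(expfzDr _ _ (invr_neq0 q0)) -!invr_expz.
rewrite -![_ ^ n%:Z]/(_ ^+ n) -![_ ^ 1]/(_) [c * b]mulrC exprVn.
move: (T) T0 => t t0; field.
by rewrite t0 q0 zeta0 q2' oner_neq0.
Qed.
Lemma bfunV (x : C) : bfun x^-1 = - bfun x.
Proof. by rewrite /bfun invrK opprB. Qed.

Variable u : 'I_n -> C.
Let u' i := (u i)^-1.

Lemma bethe_f_inv_dual (x y : C) : bethe_f p' x^-1 y^-1 = bethe_f p x y.
Proof.
rewrite /bethe_f /=.
have -> : q^-1 * y^-1 / x^-1 = (q * y / x)^-1 by rewrite !invfM.
have -> : x^-1 * y^-1 = (x * y)^-1 by rewrite invfM.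
have -> : y^-1 / x^-1 = (y / x)^-1 by rewrite !invfM.
have -> : q^-1 * x^-1 * y^-1 = (q * x * y)^-1 by rewrite !invfM.
by rewrite !bfunV !mulrNN.
Qed.

Lemma bethe_h_inv_dual (x y : C) : bethe_h p' x^-1 y^-1 = bethe_h p x y.
Proof.
rewrite /bethe_h /=.
have -> : q^-1 ^+ 2 * x^-1 * y^-1 = (q ^+ 2 * x * y)^-1 by rewrite exprVn !invfM.
have -> : q^-1 * x^-1 / y^-1 = (q * x / y)^-1 by rewrite !invfM.
have -> : x^-1 / y^-1 = (x / y)^-1 by rewrite !invfM.
have -> : q^-1 * x^-1 * y^-1 = (q * x * y)^-1 by rewrite !invfM.
by rewrite !bfunV !mulrNN.
Qed.

Lemma Lambda1_inv_dual (x : C) : x != 0 ->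
  Lambda1 n p' true x^-1 = Lambda1 n p false x.
Proof.
move=> x0; rewrite /Lambda1 /= !(expfzDr _ _ q0) !(expfzDr _ _ (invr_neq0 q0)) -!invr_expz.
rewrite -![_ ^ n%:Z]/(_ ^+ n) -![_ ^ 1]/(_) !expr0 !expr1 exprVn.
move: (T) T0 => t t0; field.
by rewrite x0 cs0 t0 zeta0 q0 oner_neq0.
Qed.

Lemma Lambda2_inv_dual (x : C) : x != 0 -> bfun (q * x ^+ 2) != 0 ->
  Lambda2 n p' true x^-1 = Lambda2 n p false x.
Proof.
move=> x0; rewrite bfun_neq0 ?mulf_neq0 ?expf_neq0 // => z0.
rewrite /Lambda2 /= !(expfzDr _ _ q0) !(expfzDr _ _ (invr_neq0 q0)) -!invr_expz.
rewrite -![_ ^ n%:Z]/(_ ^+ n) -![_ ^ 1]/(_) !expr0 !expr1 exprVn.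
move: (T) T0 => t t0; field.
by rewrite cs0 x0 t0 zeta0 q0 z0 oner_neq0 mulNr -opprB oppr_eq0 z0.
Qed.

(** The function b is odd and its signs cancel in pairs, while Lambda_1, Lambda_2 and nu pass from
    epsilon = 1 to epsilon = -1. *)
Lemma bethe_E_inv_dual i : u i != 0 -> bfun (q * u i ^+ 2) != 0 ->
  bethe_E p' true u' i = bethe_E p false u i.
Proof.
move=> u0 z0; rewrite /bethe_E /u' Lambda1_inv_dual // Lambda2_inv_dual //.
rewrite (eq_bigr _ (fun j _ => bethe_f_inv_dual (u i) (u j))).
rewrite [\prod_(j < n | _) bethe_h p' _ _](eq_bigr _ (fun j _ => bethe_h_inv_dual (u i) (u j))).
have uV : bfun ((u i)^-1 ^+ 2) = - bfun (u i ^+ 2) by rewrite exprVn bfunV.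
congr (_ - _ + _).
- congr (_ * _ * _); rewrite uV /= exprVn -invfM bfunV invrN mulrNN.
  by [].
- congr (_ * _ * _); rewrite /= !exprVn -invfM.
  by rewrite -[LHS]/(_^-1) invrK.
rewrite uV /= bfunV; congr (_ * _ * (_ / _)).
- by rewrite /nu /= exprz_inv; congr (q ^ _ * b); lia.
- by rewrite mulrN invrN mulrNN exprz_inv.
- apply: eq_bigr => k _; rewrite !exprz_inv -!invr_expz -!invfM !bfunV mulrNN.
  by [].
apply: eq_bigr => j _; rewrite -!invfM !bfunV mulrNN.
by [].
Qed.

Lemma bethe_solution_inv_dual : bethe_solution p false u -> bethe_solution p' true u'.
Proof.
case=> nt ad de eqs.
have de' i : bfun (q^-1 * (u i)^-1 ^+ 2) != 0.
  by rewrite exprVn -invfM bfunV oppr_eq0.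
split=> // [i|i j ij|i].
- have [u0 u4] := nt i; rewrite /u' invr_eq0; split=> //.
  by rewrite exprVn invrK eq_sym.
- apply: contra_neq (ad i j ij); rewrite /bethe_U /u' /= !exprVn !invrK.
  by rewrite [q^-1 + q]addrC ![q^-1 * _ + _]addrC.
by rewrite bethe_E_inv_dual //; have [] := nt i.
Qed.

Lemma energy_inv_dual : energy_plus p' u' = energy_minus p u.
Proof.
rewrite /energy_plus /energy_minus /qint /= !exprz_inv !opprK.
rewrite (eq_bigr (fun j => q * u j ^+ 2 + q^-1 * u j ^- 2)) => [|j _]; last first.
  by rewrite /u' !exprVn !invrK addrC.
move: (\sum_(_ < _) _) (q ^ (2 * n%:Z)) => S t; rewrite -!invr_expz.
rewrite -[q ^ n]/(q ^+ n); move: (T) T0 => k k0; field.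
by rewrite q0 k0 q2 zeta0 oner_neq0 mulNr -opprB oppr_eq0 q2.
Qed.

Lemma norm_inv_dual : norm_plus p' u' = norm_minus p u.
Proof.
apply: eq_bigr => k _; rewrite A_entry_inv_dual /u' /= !invrK exprVn bfunV.
by rewrite mulrN !mulNr opprK.
Qed.

Variables (V : vectType C) (A As : 'End(V)).

Lemma qcommV (t : C) (X Z : 'End(V)) : qcomm t^-1 X Z = - qcomm t Z X.
Proof. by rewrite /qcomm invrK opprB. Qed.

Lemma qcomm_swap (t : C) (X Z : 'End(V)) :
  qcomm t X (qcomm t^-1 X Z) = qcomm t^-1 X (qcomm t X Z).
Proof.
apply/lfunP => w; rewrite !qcommE !(lfunD, lfunN, lfunZ) invrK.
by apply: vec_eqP => f fD fZ fN; rewrite !(fD, fN, fZ); ring.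
Qed.

(** In the Bethe operator both b(u^2) and the bracket change sign, as [A, A*]_(1/q) = -[A*, A]_q. *)
Lemma Psi_inv_dual chi alpha m0 w :
  Psi_plus p' As A chi alpha m0 u' w = Psi_minus p A As chi alpha m0 u w.
Proof.
rewrite /Psi_plus /Psi_minus; congr (fun_of_lfun _ _).
apply: eq_bigr => i _; rewrite /B_plus /B_minus /u' /= invrK.
rewrite exprz_inv opprB opprK addrC; congr (_ *: _).
rewrite /Bop /= rho_inv_dual omega_inv_dual exprVn bfunV qcommV.
have -> : omega n p / (q^-1 - q^-1^-1) = - (omega n p / (q - q^-1)).
  by rewrite invrK -[q^-1 - q]opprB invrN mulrN.
have -> : (q^-1 / u i ^+ 2 + q^-1^-1 / u i ^- 2) / (q^-1 ^ 2 - q^-1 ^ (-2)) =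
    - ((q * u i ^+ 2 + q^-1 / u i ^+ 2) / (q ^ 2 - q ^ (-2))).
  rewrite !invrK addrC !exprz_inv opprK -[_ ^ (-2) - _]opprB invrN mulrN.
  by [].
by rewrite !scaleNr -opprD scalerN -opprD mulrN scalerN scaleNr opprK.
Qed.

Lemma bispectral_inv_dual (th ths : 'I_n.+1 -> V) :
  leonard_pair p A As th ths -> bispectral p' As A th.
Proof.
case=> dimV bth bths Ath Asths _ _ irr r rs Asth _ _.
split=> //.
- exact: inv_dual_generic.
- by move=> N; rewrite theta_star_inv_dual.
- by move=> N; rewrite Asth; apply: eq_bigr => L _; rewrite A_entry_inv_dual.
- by move=> U ? ?; apply: irr.
- by rewrite rho_inv_dual omega_inv_dual eta_inv_dual -rs /= invrK qcomm_swap.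
- by rewrite rho_inv_dual omega_inv_dual eta_star_inv_dual -r /= invrK qcomm_swap.
Qed.

Lemma bispectral_leonard (th ths : 'I_n.+1 -> V) :
  leonard_pair p A As th ths -> bispectral p A As ths.
Proof. by case=> *; split. Qed.

End Duality.

(** * The transition matrix and the two families of states *)

Section Assembly.
Variables (C : fieldType) (V : vectType C) (n : nat).
Variables (th ths : 'I_n.+1 -> V) (P : 'M[C]_n.+1).
Hypothesis th_basis : basis_of fullv [tuple th M | M < n.+1].
Hypothesis ths_basis : basis_of fullv [tuple ths M | M < n.+1].
Hypothesis P_transition : is_transition th ths P.

Lemma coord_fun (s : 'I_n.+1 -> V) (x : 'I_n.+1 -> C) L :
  basis_of fullv [tuple s M | M < n.+1] -> coef_on s L (\sum_N x N *: s N) = x L.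
Proof.
move=> /basis_free s_free.
rewrite (eq_bigr (fun N => x N *: [tuple s M | M < n.+1]`_N)) => [|N _].
  exact: coord_sum_free.
by rewrite -tnth_nth tnth_mktuple.
Qed.

Lemma coord_fun_expand (s : 'I_n.+1 -> V) w :
  basis_of fullv [tuple s M | M < n.+1] -> w = \sum_N coef_on s N w *: s N.
Proof.
move=> sb; rewrite {1}(coord_basis sb (memvf w)); apply: eq_bigr => L _.
by rewrite -tnth_nth tnth_mktuple.
Qed.

Lemma transition_coord N M : P M N = coef_on th M (ths N).
Proof. by rewrite P_transition coord_fun. Qed.

(** The matrix of these coordinates is a right inverse of P, hence its inverse as P is square. *)
Lemma transition_inv N M : (invmx P) N M = coef_on ths N (th M).
Proof.
pose Q : 'M_n.+1 := \matrix_(N, M) coef_on ths N (th M).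
have PQ : P *m Q = 1%:M.
  apply/matrixP => M' M''; rewrite !mxE.
  have := coord_fun (s := th) (fun N => (N == M'')%:R) M' th_basis.
  rewrite (bigD1 M'') //= eqxx scale1r big1 => [|i /negbTE ->]; last by rewrite scale0r.
  rewrite addr0 => <-; rewrite {1}(coord_fun_expand (th M'') ths_basis).
  rewrite /coef_on linear_sum; apply: eq_bigr => K _.
  by rewrite linearZ /= -/(coef_on th M' (ths K)) -transition_coord mxE mulrC.
have [uP _] := mulmx1_unit PQ.
have -> : invmx P = Q by rewrite -[LHS]mulmx1 -PQ mulmxA mulVmx // mul1mx.
by rewrite mxE.
Qed.

End Assembly.

Section Main.
Variables (C : fieldType) (n : nat) (p : aw_param C).
Hypothesis p_generic : generic_param n p.
Variables (V : vectType C) (A As : 'End(V)) (th ths : 'I_n.+1 -> V).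
Hypothesis A_As_leonard : leonard_pair p A As th ths.
Variable P : 'M[C]_n.+1.
Hypothesis P_transition : is_transition th ths P.
Variables (chi : C) (m0 : int).
Hypothesis chi_neq0 : chi != 0.
Let th_basis := basis_th A_As_leonard.
Let ths_basis := basis_ths A_As_leonard.

Lemma th_bethe_plus (alpha : C) (u : 'I_n -> C) (M : 'I_n.+1) :
  (par_q p ^ 2 - par_q p ^ (-2)) * chi^-1 * alpha * par_cs p * par_q p ^ m0 = 1 ->
  bethe_solution p true u -> theta p M = energy_plus p u ->
  th M = (norm_plus p u * (invmx P) ord_max M) *:
         Psi_plus p A As chi alpha m0 u (ths ord0).
Proof.
move=> alphaE us thE; rewrite (transition_inv th_basis ths_basis P_transition).
(* For n = 0 the Bethe state is the reference state, which spans V, and the claim is the expansion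
   of |theta_M> in it. *)
have [n0|n_gt0] := posnP n; last first.
  have AAs := bispectral_leonard p_generic A_As_leonard.
  exact: (th_bethe AAs n_gt0 chi_neq0 alphaE us th_basis (A_th A_As_leonard)
    (theta_inj A_As_leonard)).
subst n.
rewrite /norm_plus /Psi_plus !big_ord0 mul1r id_lfunE {1}(coord_fun_expand (th M) ths_basis).
by rewrite big_ord1 [ord_max]ord1.
Qed.

(** The eigenvector statement for A under the duality. The value -1 in the condition on alpha
    becomes 1 because q^2 - q^-2 changes sign with q -> 1/q. *)
Lemma ths_bethe_minus (alpha : C) (u : 'I_n -> C) (N : 'I_n.+1) :
  (par_q p ^ 2 - par_q p ^ (-2)) * chi^-1 * alpha * par_b p * par_q p ^ (- m0) = -1 ->
  bethe_solution p false u -> theta_star p N = energy_minus p u ->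
  ths N = (norm_minus p u * P ord_max N) *:
          Psi_minus p A As chi alpha m0 u (th ord0).
Proof.
move=> alphaE us thE; rewrite (transition_coord th_basis P_transition).
have [n0|n_gt0] := posnP n; last first.
  have AAs := bispectral_inv_dual p_generic A_As_leonard.
  have alphaE' : (par_q (inv_dual p) ^ 2 - par_q (inv_dual p) ^ (-2)) * chi^-1 *
      alpha * par_cs (inv_dual p) * par_q (inv_dual p) ^ m0 = 1.
    rewrite /= !exprz_inv opprK -[_ - _]opprB !mulNr.
    by rewrite alphaE opprK.
  have ths_eigen N' : As (ths N') = theta (inv_dual p) N' *: ths N'.
    by rewrite theta_inv_dual (As_ths A_As_leonard).
  have th_inj : injective (fun N' : 'I_n.+1 => theta (inv_dual p) N').
    move=> i j /=; rewrite !theta_inv_dual; exact: (theta_star_inj A_As_leonard).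
  rewrite -(norm_inv_dual p_generic) -(Psi_inv_dual p_generic).
  apply: (th_bethe AAs n_gt0 chi_neq0 alphaE' (bethe_solution_inv_dual p_generic us)
    ths_basis ths_eigen th_inj).
  by rewrite theta_inv_dual thE (energy_inv_dual p_generic).
subst n.
rewrite /norm_minus /Psi_minus !big_ord0 mul1r id_lfunE {1}(coord_fun_expand (ths N) th_basis).
by rewrite big_ord1 [ord_max]ord1.
Qed.
End Main.

Local Open Scope complex_scope.

Theorem lemma3p7 (R : realType) (n : nat) (p : aw_param R[i])
    (p_generic : generic_param n p)
    (V : vectType R[i]) (A As : 'End(V)) (th ths : 'I_n.+1 -> V)
    (A_As_leonard : leonard_pair p A As th ths)
    (P : 'M[R[i]]_n.+1) (P_transition : is_transition th ths P)
    (chi : R[i]) (chi_neq0 : chi != 0) (m0 : int)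
    (alpha_minus alpha_plus : R[i])
    (alpha_minusE : (par_q p ^ 2 - par_q p ^ (-2)) * chi^-1 * alpha_minus *
                    par_b p * par_q p ^ (- m0) = -1)
    (alpha_plusE : (par_q p ^ 2 - par_q p ^ (-2)) * chi^-1 * alpha_plus *
                   par_cs p * par_q p ^ m0 = 1)
    (Splus Sminus : 'I_n.+1 -> 'I_n -> R[i])
    (Splus_solution : forall M : 'I_n.+1,
       bethe_solution p true (Splus M) /\
       theta p M = energy_plus p (Splus M))
    (Sminus_solution : forall N : 'I_n.+1,
       bethe_solution p false (Sminus N) /\
       theta_star p N = energy_minus p (Sminus N)) :
  (forall M : 'I_n.+1,
     th M = (norm_plus p (Splus M) * (invmx P) ord_max M) *:
            Psi_plus p A As chi alpha_plus m0 (Splus M) (ths ord0)) /\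
  (forall N : 'I_n.+1,
     ths N = (norm_minus p (Sminus N) * P ord_max N) *:
             Psi_minus p A As chi alpha_minus m0 (Sminus N) (th ord0)).
Proof.
split=> [M|N].
  have [us thE] := Splus_solution M.
  exact: (th_bethe_plus p_generic A_As_leonard P_transition chi_neq0 alpha_plusE).
have [us thE] := Sminus_solution N.
exact: (ths_bethe_minus p_generic A_As_leonard P_transition chi_neq0 alpha_minusE).
Qed.
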